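(* Over $\mathsf{RCA}_0$ the following are equivalent: (i) $\mathsf{WKL}_0$; (ii) every partial order is a proper 1-1 interval order if and only if it contains neither $\mathbf{2}\oplus\mathbf{2}$ nor $\mathbf{3}\oplus\mathbf{1}$; (iii) every partial order is a proper closed interval order if and only if it contains neither $\mathbf{2}\oplus\mathbf{2}$ nor $\mathbf{3}\oplus\mathbf{1}$; (iv) every partial order is a proper 1-1 closed interval order if and only if it contains neither $\mathbf{2}\oplus\mathbf{2}$ nor $\mathbf{3}\oplus\mathbf{1}$; (v) every partial order is a proper distinguishing interval order if and only if it contains neither $\mathbf{2}\oplus\mathbf{2}$ nor $\mathbf{3}\oplus\mathbf{1}$.
   Context: $\mathsf{RCA}_0$ is the base subsystem of second-order arithmetic ($\Delta^0_1$ comprehension, $\Sigma^0_1$ induction); $\mathsf{WKL}_0$ is $\mathsf{RCA}_0$ plus Weak König's Lemma (every infinite tree of finite $0$-$1$ sequences has an infinite path). A partial order $\mathbf{P}=(P,\leq_P)$ is a set $P\subseteq\mathbb{N}$ with a reflexive, transitive, antisymmetric relation; a linear order has any two elements comparable; $p<_P q$ means $p\leq_P q$, $p\ne q$. Given a linear order $\mathbf{L}=(L,\leq_L)$ and $F\subseteq P\times L$, write $F(p)=\{x:(p,x)\in F\}$ and consider: (i1) each $F(p)$ nonempty and convex in $\mathbf{L}$; (i2) $p<_P q$ iff $x<_L y$ for all $x\in F(p),y\in F(q)$; (i3) $F(p)\ne F(q)$ whenever $p\ne q$; (i4) $F(p)\subseteq F(q)$ implies $F(p)=F(q)$. $\mathbf{P}$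 is a proper 1-1 interval order if some $\mathbf{L},F$ satisfy (i1),(i2),(i3),(i4). Given a linear order $\mathbf{L}$ and $f_0,f_1:P\to L$ consider: (c1) $f_0(p)\leq_L f_1(p)$; (c2) $p<_P q$ iff $f_1(p)<_L f_0(q)$; (c3) $f_0(p)\ne f_0(q)$ or $f_1(p)\ne f_1(q)$ whenever $p\ne q$; (c4) $f_i(p)\ne f_j(q)$ whenever $p\ne q$ or $i\ne j$; (c5) $f_0(p)<_L f_0(q)$ iff $f_1(p)<_L f_1(q)$, for all $p,q$. $\mathbf{P}$ is a proper closed interval order if some $\mathbf{L},f_0,f_1$ satisfy (c1),(c2),(c5); a proper 1-1 closed interval order if they satisfy (c1),(c2),(c3),(c5); a proper distinguishing interval order if they satisfy (c1),(c2),(c4),(c5). $\mathbf{P}$ does not contain $\mathbf{2}\oplus\mathbf{2}$ if $p_0<_P q_0$, $p_1<_P q_1$ imply $p_0\leq_P q_1$ or $p_1\leq_P q_0$; it does not contain $\mathbf{3}\oplus\mathbf{1}$ if $p_0<_P p_1<_P p_2$ implies $p_0\leq_P q$ or $q\leq_P p_2$ for all $q$. *)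

(* Defs.v *)
(** Second-order arithmetic is treated semantically: a theorem "over RCA_0" is
    a statement true in every L2-structure, standard or not, that satisfies the
    axioms of RCA_0.  All number quantifiers range over [num M] and all set
    quantifiers over [sset M].  *)

Set Implicit Arguments.
Unset Strict Implicit.

(** Two-sorted structures for the language of second-order arithmetic.
    Number equality is interpreted as identity.  Equality of sets is not a
    primitive of L2: two sets are equal when they have the same elements, so
    no extensionality is imposed on [sset], and [=] is never used on it. *)
Record L2_structure : Type := {
  num : Type;
  sset : Type;
  zero : num;
  one : num;
  add : num -> num -> num;
  mul : num -> num -> num;
  lt : num -> num -> Prop;
  mem : num -> sset -> Prop;
  sset_inhabited : inhabited sset
}.

Arguments zero {l}.
Arguments one {l}.
Arguments add {l} _ _.
Arguments mul {l} _ _.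
Arguments lt {l} _ _.
Arguments mem {l} _ _.

Declare Scope L2_scope.
Delimit Scope L2_scope with L2.
Bind Scope L2_scope with num.
Notation "0" := zero : L2_scope.
Notation "1" := one : L2_scope.
Infix "+" := add : L2_scope.
Infix "*" := mul : L2_scope.
Infix "<" := lt : L2_scope.
Local Open Scope L2_scope.

(** * Bounded-quantifier formulas (Delta^0_0), with de Bruijn number variables
    and free set variables serving as parameters. *)

Inductive term : Type :=
  | tvar (i : nat)
  | tzero
  | tone
  | tadd (t u : term)
  | tmul (t u : term).

Inductive formula0 : Type :=
  | feq (t u : term)
  | flt (t u : term)
  | fmem (t : term) (X : nat)
  | fnot (f : formula0)
  | fand (f g : formula0)
  | for_ (f g : formula0)
  | fimp (f g : formula0)
  | fball (t : term) (f : formula0)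
  | fbex (t : term) (f : formula0).

Definition scons {A : Type} (a : A) (v : nat -> A) (i : nat) : A :=
  match i with O => a | S j => v j end.

Fixpoint eval {M : L2_structure} (v : nat -> num M) (t : term) : num M :=
  match t with
  | tvar i => v i
  | tzero => 0
  | tone => 1
  | tadd t u => eval v t + eval v u
  | tmul t u => eval v t * eval v u
  end.

(** The bound of a bounded quantifier is evaluated outside the quantifier, so
    the bound variable cannot occur in it. *)
Fixpoint sat {M : L2_structure} (v : nat -> num M) (V : nat -> sset M)
    (f : formula0) : Prop :=
  match f with
  | feq t u => eval v t = eval v u
  | flt t u => eval v t < eval v u
  | fmem t X => mem (eval v t) (V X)
  | fnot f => ~ sat v V f
  | fand f g => sat v V f /\ sat v V g
  | for_ f g => sat v V f \/ sat v V g
  | fimp f g => sat v V f -> sat v V g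
  | fball t f => forall x, x < eval v t -> sat (scons x v) V f
  | fbex t f => exists x, x < eval v t /\ sat (scons x v) V f
  end.

(** The Sigma^0_1 formula "exists k, f(k, n)" and the Pi^0_1 formula
    "for all k, f(k, n)", where [f] is Delta^0_0, variable 0 stands for [k],
    variable 1 for [n], and [v], [V] give the values of the parameters. *)
Definition sigma1 {M : L2_structure} (v : nat -> num M) (V : nat -> sset M)
    (f : formula0) (n : num M) : Prop :=
  exists k, sat (scons k (scons n v)) V f.

Definition pi1 {M : L2_structure} (v : nat -> num M) (V : nat -> sset M)
    (f : formula0) (n : num M) : Prop :=
  forall k, sat (scons k (scons n v)) V f.

(** * The axioms of RCA_0 *)

Record basic_axioms (M : L2_structure) : Prop := {
  succ_neq0 : forall n : num M, n + 1 <> 0;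
  succ_inj : forall m n : num M, m + 1 = n + 1 -> m = n;
  add_zero : forall m : num M, m + 0 = m;
  add_succ : forall m n : num M, m + (n + 1) = (m + n) + 1;
  mul_zero : forall m : num M, m * 0 = 0;
  mul_succ : forall m n : num M, m * (n + 1) = (m * n) + m;
  not_lt_zero : forall m : num M, ~ m < 0;
  lt_succ : forall m n : num M, m < n + 1 <-> (m < n \/ m = n)
}.

Definition sigma1_induction (M : L2_structure) : Prop :=
  forall (f : formula0) (v : nat -> num M) (V : nat -> sset M),
    sigma1 v V f 0 ->
    (forall n, sigma1 v V f n -> sigma1 v V f (n + 1)) ->
    forall n, sigma1 v V f n.

Definition delta1_comprehension (M : L2_structure) : Prop :=
  forall (f g : formula0) (v : nat -> num M) (V : nat -> sset M),
    (forall n, sigma1 v V f n <-> pi1 v V g n) ->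
    exists X : sset M, forall n, mem n X <-> sigma1 v V f n.

Definition RCA0 (M : L2_structure) : Prop :=
  basic_axioms M /\ sigma1_induction M /\ delta1_comprehension M.

(** * Codes for pairs, finite sets and finite sequences (as in Simpson,
    "Subsystems of Second Order Arithmetic", Section II.2) *)

Definition npair {M : L2_structure} (i j : num M) : num M :=
  (i + j) * (i + j) + i.

(** The triple (k, (m, n)) represents the finite set of all [i < k] such that
    [m * (i + 1) + 1] divides [n]; the code of a finite set is the least triple
    representing it. *)
Definition is_triple {M : L2_structure} (s : num M) : Prop :=
  exists k m n, s = npair k (npair m n).

Definition elt {M : L2_structure} (i s : num M) : Prop :=
  exists k m n, s = npair k (npair m n) /\ i < k /\
    exists d, n = d * (m * (i + 1) + 1).

Definition finset_code {M : L2_structure} (s : num M) : Prop :=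
  is_triple s /\
  forall t, is_triple t -> (forall i, elt i t <-> elt i s) -> ~ t < s.

(** A finite sequence is identified with (the code of) its graph. *)
Definition finseq {M : L2_structure} (s l : num M) : Prop :=
  finset_code s /\
  (forall u, elt u s -> exists i x, u = npair i x /\ i < l) /\
  (forall i, i < l -> exists! x, elt (npair i x) s).

Definition binseq {M : L2_structure} (s l : num M) : Prop :=
  finseq s l /\ forall i x, elt (npair i x) s -> x = 0 \/ x = 1.

(** * Functions, coded as sets of pairs *)

Definition maps {M : L2_structure} (f : sset M) (p x : num M) : Prop :=
  mem (npair p x) f.

Definition sub_prod {M : L2_structure} (F : sset M) (A B : num M -> Prop) :
    Prop :=
  forall u, mem u F -> exists p x, u = npair p x /\ A p /\ B x.

Definition is_function {M : L2_structure} (f : sset M) (A B : num M -> Prop) :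
    Prop :=
  sub_prod f A B /\ forall p, A p -> exists! x, maps f p x.

(** * Weak Koenig's Lemma *)

Definition binary_tree {M : L2_structure} (T : sset M) : Prop :=
  (forall s, mem s T -> exists l, binseq s l) /\
  (forall s t k, mem s T -> finseq t k -> (forall u, elt u t -> elt u s) ->
     mem t T).

Definition infinite {M : L2_structure} (X : sset M) : Prop :=
  forall k, exists n, mem n X /\ ~ n < k.

Definition path {M : L2_structure} (T g : sset M) : Prop :=
  is_function g (fun _ => True) (fun x => x = 0 \/ x = 1) /\
  forall n, exists s, mem s T /\ finseq s n /\
    forall i x, i < n -> (elt (npair i x) s <-> maps g i x).

Definition WKL (M : L2_structure) : Prop :=
  forall T : sset M, binary_tree T -> infinite T -> exists g, path T g.

Definition WKL0 (M : L2_structure) : Prop := RCA0 M /\ WKL M.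

(** * Partial and linear orders *)

Record rel_structure (M : L2_structure) : Type := {
  dom : sset M;
  leq_graph : sset M
}.

Arguments dom {M} _.
Arguments leq_graph {M} _.

Definition indom {M : L2_structure} (P : rel_structure M) (p : num M) : Prop :=
  mem p (dom P).

Definition ole {M : L2_structure} (P : rel_structure M) (p q : num M) : Prop :=
  mem (npair p q) (leq_graph P).

Definition olt {M : L2_structure} (P : rel_structure M) (p q : num M) : Prop :=
  ole P p q /\ p <> q.

Definition partial_order {M : L2_structure} (P : rel_structure M) : Prop :=
  sub_prod (leq_graph P) (indom P) (indom P) /\
  (forall p, indom P p -> ole P p p) /\
  (forall p q r, ole P p q -> ole P q r -> ole P p r) /\
  (forall p q, ole P p q -> ole P q p -> p = q).

Definition linear_order {M : L2_structure} (L : rel_structure M) : Prop :=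
  partial_order L /\
  forall x y, indom L x -> indom L y -> ole L x y \/ ole L y x.

Definition no_2plus2 {M : L2_structure} (P : rel_structure M) : Prop :=
  forall p0 q0 p1 q1, olt P p0 q0 -> olt P p1 q1 -> ole P p0 q1 \/ ole P p1 q0.

Definition no_3plus1 {M : L2_structure} (P : rel_structure M) : Prop :=
  forall p0 p1 p2 q, indom P q -> olt P p0 p1 -> olt P p1 p2 ->
    ole P p0 q \/ ole P q p2.

(** * Interval representations.  For [F] a subset of [P * L], the set F(p) is
    [{x | maps F p x}]. *)

Definition i1 {M : L2_structure} (P L : rel_structure M) (F : sset M) : Prop :=
  forall p, indom P p ->
    (exists x, maps F p x) /\
    (forall x y z, maps F p x -> maps F p z -> olt L x y -> olt L y z ->
       maps F p y).

Definition i2 {M : L2_structure} (P L : rel_structure M) (F : sset M) : Prop :=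
  forall p q, indom P p -> indom P q ->
    (olt P p q <-> (forall x y, maps F p x -> maps F q y -> olt L x y)).

Definition i3 {M : L2_structure} (P : rel_structure M) (F : sset M) : Prop :=
  forall p q, indom P p -> indom P q -> p <> q ->
    ~ (forall x, maps F p x <-> maps F q x).

Definition i4 {M : L2_structure} (P : rel_structure M) (F : sset M) : Prop :=
  forall p q, indom P p -> indom P q ->
    (forall x, maps F p x -> maps F q x) ->
    (forall x, maps F p x <-> maps F q x).

Definition proper_11_interval_order {M : L2_structure} (P : rel_structure M) :
    Prop :=
  exists (L : rel_structure M) (F : sset M),
    linear_order L /\ sub_prod F (indom P) (indom L) /\
    i1 P L F /\ i2 P L F /\ i3 P F /\ i4 P F.

(** In the conditions below [f0] and [f1] are functions from P to L, so
    [maps f0 p x] reads f_0(p) = x. *)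

Definition c1 {M : L2_structure} (L : rel_structure M) (f0 f1 : sset M) :
    Prop :=
  forall p x y, maps f0 p x -> maps f1 p y -> ole L x y.

Definition c2 {M : L2_structure} (P L : rel_structure M) (f0 f1 : sset M) :
    Prop :=
  forall p q x y, maps f1 p x -> maps f0 q y -> (olt P p q <-> olt L x y).

Definition c3 {M : L2_structure} (f0 f1 : sset M) : Prop :=
  forall p q x x' y y', p <> q -> maps f0 p x -> maps f0 q x' ->
    maps f1 p y -> maps f1 q y' -> x <> x' \/ y <> y'.

Definition c4 {M : L2_structure} (f0 f1 : sset M) : Prop :=
  forall (i j : bool) p q x y, p <> q \/ i <> j ->
    maps (if i then f1 else f0) p x -> maps (if j then f1 else f0) q y ->
    x <> y.

Definition c5 {M : L2_structure} (L : rel_structure M) (f0 f1 : sset M) :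
    Prop :=
  forall p q x x' y y', maps f0 p x -> maps f0 q x' ->
    maps f1 p y -> maps f1 q y' -> (olt L x x' <-> olt L y y').

Definition endpoint_functions {M : L2_structure} (P L : rel_structure M)
    (f0 f1 : sset M) : Prop :=
  linear_order L /\
  is_function f0 (indom P) (indom L) /\ is_function f1 (indom P) (indom L).

Definition proper_closed_interval_order {M : L2_structure}
    (P : rel_structure M) : Prop :=
  exists L f0 f1, endpoint_functions P L f0 f1 /\
    c1 L f0 f1 /\ c2 P L f0 f1 /\ c5 L f0 f1.

Definition proper_11_closed_interval_order {M : L2_structure}
    (P : rel_structure M) : Prop :=
  exists L f0 f1, endpoint_functions P L f0 f1 /\
    c1 L f0 f1 /\ c2 P L f0 f1 /\ c3 f0 f1 /\ c5 L f0 f1.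

Definition proper_distinguishing_interval_order {M : L2_structure}
    (P : rel_structure M) : Prop :=
  exists L f0 f1, endpoint_functions P L f0 f1 /\
    c1 L f0 f1 /\ c2 P L f0 f1 /\ c4 f0 f1 /\ c5 L f0 f1.

(* Main.v *)
(** Weak Koenig's Lemma is used through Sigma^0_1 separation, to which it is
    equivalent over RCA_0.

    From separation to representations: in an order without 2+2 and 3+1 the
    trace relation "some r is below q but not below p, or above p but not above
    q" is a Sigma^0_1 strict weak order on points.  A set separating it from its
    converse yields a linear order of the points respecting the trace.  The left
    endpoints are placed in this order, the right endpoints in the same order,
    and the right endpoint of p before the left endpoint of q exactly when
    p < q; this distinguishing representation induces all the others.

    From representations to separation: given disjoint Sigma^0_1 sets A and B,
    stack blocks each containing two incomparable points a_n, b_n, adding to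
    block n a point below b_n only when n is seen to enter A and one below a_n
    only when n is seen to enter B.  In any representation the relative position
    of the intervals of a_n and b_n is decidable and separates A from B. *)

(* The model may be nonstandard, so the ambient induction and recursion say nothing about [num M]:
   every induction has to run on a Sigma^0_1 predicate, and every set has to come from a Delta^0_1
   one. Predicates are kept as functions of an environment, with a semantic certificate of
   definability ([D0], [Sig], [Del], [Fn]) whose closure properties replace the writing of formulas.
   Recursion is replaced by the existence of coded finite histories.

   Getting a path from separation cannot rest on asking which child of a node has infinitely many
   descendants: that is a Pi^0_1 question, not open to comprehension. The question asked instead is
   which child runs out of descendants first. Its two answers are disjoint Sigma^0_1 sets of nodes,
   and any set separating them prescribes a safe turn everywhere: as long as a node has a descendant
   at a given level, so does the prescribed child. *)
Require Import Defs.
From Stdlib Require Import Arith Classical Ring.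

Set Implicit Arguments.
Unset Strict Implicit.
Local Open Scope L2_scope.

(** * Renaming in formulas *)

Section Renaming.

Fixpoint ren_term (r : nat -> nat) (t : term) : term :=
  match t with
  | tvar i => tvar (r i)
  | tzero => tzero
  | tone => tone
  | tadd t u => tadd (ren_term r t) (ren_term r u)
  | tmul t u => tmul (ren_term r t) (ren_term r u)
  end.

Definition ren_up (r : nat -> nat) : nat -> nat :=
  scons O (fun i => S (r i)).

Fixpoint ren_form (r s : nat -> nat) (f : formula0) : formula0 :=
  match f with
  | feq t u => feq (ren_term r t) (ren_term r u)
  | flt t u => flt (ren_term r t) (ren_term r u)
  | fmem t X => fmem (ren_term r t) (s X)
  | fnot f => fnot (ren_form r s f)
  | fand f g => fand (ren_form r s f) (ren_form r s g)
  | for_ f g => for_ (ren_form r s f) (ren_form r s g)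
  | fimp f g => fimp (ren_form r s f) (ren_form r s g)
  | fball t f => fball (ren_term r t) (ren_form (ren_up r) s f)
  | fbex t f => fbex (ren_term r t) (ren_form (ren_up r) s f)
  end.

Lemma eval_ren (M : L2_structure) r (v w : nat -> num M) t :
  (forall i, w (r i) = v i) -> eval w (ren_term r t) = eval v t.
Proof. intros H; induction t; simpl; congruence. Qed.

Lemma sat_ren (M : L2_structure) f r s (v w : nat -> num M) V W :
  (forall i, w (r i) = v i) -> (forall j, W (s j) = V j) ->
  (sat w W (ren_form r s f) <-> sat v V f).
Proof.
  intros Hr Hs; revert r v w Hr; induction f; intros r v w Hr; simpl;
    rewrite ?(eval_ren _ Hr), ?Hs;
    try (rewrite (IHf1 _ _ _ Hr), (IHf2 _ _ _ Hr)); try tauto.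
  1: now rewrite (IHf _ _ _ Hr).
  all: assert (Hu : forall x i, scons x w (ren_up r i) = scons x v i)
    by (intros x [|i]; simpl; auto).
  - split; intros H x Hx; apply (IHf _ _ _ (Hu x)), H, Hx.
  - split; intros [x [Hx H]]; exists x; (split; [exact Hx|]);
      apply (IHf _ _ _ (Hu x)), H.
Qed.

(** Interleaving leaves infinitely many slots for both halves, so arguments can be pushed and
    parameters merged without counting the variables of a formula. *)
Definition mix {A : Type} (v w : nat -> A) (i : nat) : A :=
  if Nat.even i then v (Nat.div2 i) else w (Nat.div2 i).

Definition on_parity (f g : nat -> nat) (i : nat) : nat :=
  if Nat.even i then f (Nat.div2 i) else g (Nat.div2 i).

Lemma mix_even A (v w : nat -> A) k : mix v w (2 * k)%nat = v k.
Proof. unfold mix. rewrite Nat.even_even, Nat.div2_double; reflexivity. Qed.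

Lemma mix_odd A (v w : nat -> A) k : mix v w (S (2 * k))%nat = w k.
Proof.
  unfold mix. rewrite Nat.even_succ, <- Nat.negb_even, Nat.even_even.
  rewrite Nat.div2_succ_double; reflexivity.
Qed.

Lemma on_parity_spec A (u v w : nat -> A) f g :
  (forall k, u (f k) = v k) -> (forall k, u (g k) = w k) ->
  forall i, u (on_parity f g i) = mix v w i.
Proof.
  intros Hf Hg i; unfold on_parity, mix; destruct (Nat.even i); auto.
Qed.

End Renaming.

(* The tail of an environment is kept as a notation so that predicates on
   environments normalise by beta and eta alone. *)
Notation tl v := (fun i : nat => v (S i)).

(** * Definability with parameters *)

Section Bounded.

Context (M : L2_structure).

Notation env := (nat -> num M).

(* Number parameters [w] sit at the odd variables and set parameters in [V];
   the even variables hold the arguments. *)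
Definition Tm (t : env -> num M) : Prop :=
  exists tau w, forall v, t v = eval (mix v w) tau.

Definition D0 (P : env -> Prop) : Prop :=
  exists f w V, forall v, P v <-> sat (mix v w) V f.

Lemma Tm_var i : Tm (fun v => v i).
Proof.
  exists (tvar (2 * i)%nat), (fun _ => 0); intros v.
  symmetry; apply mix_even.
Qed.

Lemma Tm_const c : Tm (fun _ => c).
Proof.
  exists (tvar 1), (fun _ => c); intros v; reflexivity.
Qed.

(** Two definitions with parameters [w1] and [w2] are brought over the common list [mix w1 w2]:
    arguments stay in place, and the parameters of each definition move to its own half. *)
Definition ren_left : nat -> nat :=
  on_parity (fun k => 2 * k)%nat (fun k => S (2 * (2 * k)))%nat.
Definition ren_right : nat -> nat :=
  on_parity (fun k => 2 * k)%nat (fun k => S (2 * S (2 * k)))%nat.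

Lemma ren_left_spec A (v w1 w2 : nat -> A) i :
  mix v (mix w1 w2) (ren_left i) = mix v w1 i.
Proof.
  apply (on_parity_spec (u := mix v (mix w1 w2))); intros k.
  - apply mix_even.
  - now rewrite mix_odd, mix_even.
Qed.

Lemma ren_right_spec A (v w1 w2 : nat -> A) i :
  mix v (mix w1 w2) (ren_right i) = mix v w2 i.
Proof.
  apply (on_parity_spec (u := mix v (mix w1 w2))); intros k.
  - apply mix_even.
  - now rewrite !mix_odd.
Qed.

Lemma Tm_merge t u : Tm t -> Tm u ->
  exists tau ups w, forall v,
    t v = eval (mix v w) tau /\ u v = eval (mix v w) ups.
Proof.
  intros [tau [w1 H1]] [ups [w2 H2]].
  exists (ren_term ren_left tau), (ren_term ren_right ups), (mix w1 w2).
  intros v; rewrite H1, H2; split; symmetry; apply eval_ren.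
  - apply ren_left_spec.
  - apply ren_right_spec.
Qed.

Lemma Tm_add t u : Tm t -> Tm u -> Tm (fun v => t v + u v).
Proof.
  intros Ht Hu; destruct (Tm_merge Ht Hu) as [tau [ups [w H]]].
  exists (tadd tau ups), w; intros v; destruct (H v); simpl; congruence.
Qed.

Lemma Tm_mul t u : Tm t -> Tm u -> Tm (fun v => t v * u v).
Proof.
  intros Ht Hu; destruct (Tm_merge Ht Hu) as [tau [ups [w H]]].
  exists (tmul tau ups), w; intros v; destruct (H v); simpl; congruence.
Qed.

Lemma D0_ext P Q : (forall v, P v <-> Q v) -> D0 P -> D0 Q.
Proof.
  intros H [f [w [V Hf]]]; exists f, w, V; intros v; now rewrite <- H.
Qed.

Lemma D0_eq t u : Tm t -> Tm u -> D0 (fun v => t v = u v).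
Proof.
  intros Ht Hu; destruct (Tm_merge Ht Hu) as [tau [ups [w H]]].
  destruct (sset_inhabited M) as [X].
  exists (feq tau ups), w, (fun _ => X); intros v; destruct (H v) as [-> ->].
  reflexivity.
Qed.

Lemma D0_lt t u : Tm t -> Tm u -> D0 (fun v => t v < u v).
Proof.
  intros Ht Hu; destruct (Tm_merge Ht Hu) as [tau [ups [w H]]].
  destruct (sset_inhabited M) as [X].
  exists (flt tau ups), w, (fun _ => X); intros v; destruct (H v) as [-> ->].
  reflexivity.
Qed.

Lemma D0_mem t X : Tm t -> D0 (fun v => mem (t v) X).
Proof.
  intros [tau [w H]]; exists (fmem tau O), w, (fun _ => X); intros v.
  rewrite H; reflexivity.
Qed.

Lemma D0_merge P Q : D0 P -> D0 Q ->
  exists f g w V, forall v,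
    (P v <-> sat (mix v w) V f) /\ (Q v <-> sat (mix v w) V g).
Proof.
  intros [f [w1 [V1 H1]]] [g [w2 [V2 H2]]].
  exists (ren_form ren_left (fun j => 2 * j)%nat f),
    (ren_form ren_right (fun j => S (2 * j))%nat g), (mix w1 w2), (mix V1 V2).
  intros v; rewrite H1, H2; split; symmetry; apply sat_ren; intros k.
  - apply ren_left_spec.
  - apply mix_even.
  - apply ren_right_spec.
  - apply mix_odd.
Qed.

Lemma D0_not P : D0 P -> D0 (fun v => ~ P v).
Proof.
  intros [f [w [V H]]]; exists (fnot f), w, V; intros v; simpl.
  now rewrite H.
Qed.

Lemma D0_and P Q : D0 P -> D0 Q -> D0 (fun v => P v /\ Q v).
Proof.
  intros HP HQ; destruct (D0_merge HP HQ) as [f [g [w [V H]]]].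
  exists (fand f g), w, V; intros v; simpl; destruct (H v); tauto.
Qed.

Lemma D0_or P Q : D0 P -> D0 Q -> D0 (fun v => P v \/ Q v).
Proof.
  intros HP HQ; destruct (D0_merge HP HQ) as [f [g [w [V H]]]].
  exists (for_ f g), w, V; intros v; simpl; destruct (H v); tauto.
Qed.

(** A frozen argument becomes a new parameter, interleaved with the old ones. Describing [F v]
    pointwise avoids functional extensionality for environments. *)
Lemma D0_inst (s : nat -> nat + num M) (F : env -> env) P :
  D0 P ->
  (forall v i, F v i = match s i with inl j => v j | inr c => c end) ->
  D0 (fun v => P (F v)).
Proof.
  intros [f [w [V H]]] HF.
  pose (c i := match s i with inl _ => 0 | inr a => a end).
  exists (ren_form (on_parity
            (fun k => match s k with inl j => 2 * j | inr _ => S (2 * (2 * k)) end)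
            (fun k => S (2 * S (2 * k))))%nat (fun j => j) f), (mix c w), V.
  intros v; rewrite H; symmetry; apply sat_ren; [|reflexivity].
  apply (on_parity_spec (u := mix v (mix c w))); intros k.
  - rewrite HF; destruct (s k) as [j|a] eqn:E; [apply mix_even|].
    rewrite mix_odd, mix_even; unfold c; now rewrite E.
  - now rewrite !mix_odd.
Qed.

Lemma D0_sub (r : nat -> nat) (F : env -> env) P :
  D0 P -> (forall v i, F v i = v (r i)) -> D0 (fun v => P (F v)).
Proof. intros HP HF; now apply D0_inst with (s := fun i => inl (r i)). Qed.

Lemma D0_ren (r : nat -> nat) P : D0 P -> D0 (fun v => P (fun i => v (r i))).
Proof. intros HP; now apply D0_sub with (r := r) (F := fun v i => v (r i)). Qed.

Lemma Tm_ren (r : nat -> nat) t : Tm t -> Tm (fun v => t (fun i => v (r i))).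
Proof.
  intros [tau [w H]].
  exists (ren_term (on_parity (fun k => 2 * r k) (fun k => S (2 * k)))%nat tau), w.
  intros v; rewrite H; symmetry; apply eval_ren.
  apply (on_parity_spec (u := mix v w)); intros k.
  - apply mix_even.
  - apply mix_odd.
Qed.

(** A bounded quantifier pushes its variable in front of the interleaved list and so shifts all
    parities; this renaming undoes the shift. *)
Lemma mix_scons (x : num M) (v w : env) i :
  scons x (mix v w)
    (on_parity (fun k => match k with O => O | S j => S (2 * j) end)
       (fun k => S (S (2 * k))) i)%nat = mix (scons x v) w i.
Proof.
  apply (on_parity_spec (u := scons x (mix v w))).
  - intros [|k]; [reflexivity | exact (mix_even v w k)].
  - intros k; exact (mix_odd v w k).
Qed.

Lemma D0_bex (R : num M -> env -> Prop) t :
  Tm t -> D0 (fun v => R (v O) (tl v)) -> D0 (fun v => exists x, x < t v /\ R x v).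
Proof.
  intros [tau [w1 H1]] [f [w2 [V H2]]].
  eexists (fbex (ren_term ren_left tau)
    (ren_form _ (fun j => j) (ren_form ren_right (fun j => j) f))), (mix w1 w2), V.
  intros v; simpl.
  rewrite (eval_ren _ (ren_left_spec v w1 w2)), <- H1.
  split; intros [x [Hx H]]; exists x; (split; [exact Hx|]).
  - apply (sat_ren _ (mix_scons x v (mix w1 w2)) (fun j => eq_refl (V j))).
    apply (sat_ren _ (ren_right_spec (scons x v) w1 w2) (fun j => eq_refl (V j))).
    now apply H2.
  - apply (sat_ren _ (mix_scons x v (mix w1 w2)) (fun j => eq_refl (V j))) in H.
    apply (sat_ren _ (ren_right_spec (scons x v) w1 w2) (fun j => eq_refl (V j))) in H.
    now apply H2 in H.
Qed.

Lemma D0_ball (R : num M -> env -> Prop) t :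
  Tm t -> D0 (fun v => R (v O) (tl v)) -> D0 (fun v => forall x, x < t v -> R x v).
Proof.
  intros Ht HR.
  apply D0_ext with (P := fun v => ~ exists x, x < t v /\ ~ R x v).
  - intros v; split.
    + intros H x Hx; apply NNPP; intros Hn; apply H; eauto.
    + intros H [x [Hx Hn]]; auto.
  - apply D0_not, (D0_bex (R := fun x v => ~ R x v)); [exact Ht|].
    now apply D0_not.
Qed.

(* Reading [scons k (scons n (mix v w))], the environment of [sigma1], as the
   interleaving of [scons k (scons n v)] with the parameters. *)
Definition ren_sigma1 : nat -> nat :=
  on_parity (fun k => match k with O => O | S O => 1 | S (S j) => S (S (2 * j)) end)%nat
    (fun k => S (S (S (2 * k))))%nat.

Lemma mix_sigma1 (k n : num M) (v w : env) i :
  scons k (scons n (mix v w)) (ren_sigma1 i) = mix (scons k (scons n v)) w i.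
Proof.
  apply (on_parity_spec (u := scons k (scons n (mix v w)))).
  - intros [|[|j]]; [reflexivity..|exact (mix_even v w j)].
  - intros j; exact (mix_odd v w j).
Qed.

End Bounded.

(** * Sigma^0_1 and Delta^0_1 predicates on environments *)

Section Definability.

Context (M : L2_structure).

Notation env := (nat -> num M).

Definition Sig (P : env -> Prop) : Prop :=
  exists Q, D0 Q /\ forall v, P v <-> exists k, Q (scons k v).

Definition Del (P : env -> Prop) : Prop := Sig P /\ Sig (fun v => ~ P v).

(** Since [t] is total, a Sigma^0_1 graph is already Delta^0_1, so such a [t] may be substituted
    into both halves of [Del]. *)
Definition Fn (t : env -> num M) : Prop := Sig (fun v => v O = t (tl v)).

Lemma Sig_ext P Q : (forall v, P v <-> Q v) -> Sig P -> Sig Q.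
Proof.
  intros H [R [HR HP]]; exists R; split; [exact HR|]; intros v; now rewrite <- H.
Qed.

Lemma Sig_ex0 (R : num M -> env -> Prop) :
  D0 (fun v => R (v O) (tl v)) -> Sig (fun v => exists k, R k v).
Proof.
  intros H; exists (fun v => R (v O) (tl v)); split; [exact H|]; intros v; reflexivity.
Qed.

Lemma Sig_D0 P : D0 P -> Sig P.
Proof.
  intros H; apply Sig_ext with (P := fun v => exists k : num M, P v).
  - intros v; split; [intros [_ Hv] | exists 0]; assumption.
  - apply (Sig_ex0 (R := fun _ => P)), (D0_ren S H).
Qed.

(** Comprehension takes two formulas under one assignment of parameters, hence the common [w] and
    [V]. *)
Lemma Sig_formulas (P Q : num M -> Prop) :
  Sig (fun v => P (v O)) -> Sig (fun v => Q (v O)) ->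
  exists f g w V, forall n,
    (P n <-> sigma1 w V f n) /\ (Q n <-> sigma1 w V g n).
Proof.
  intros [P' [HP' HP]] [Q' [HQ' HQ]].
  destruct (D0_merge HP' HQ') as [f [g [w [V H]]]].
  pose (z := fun _ : nat => @zero M).
  exists (ren_form ren_sigma1 (fun j => j) f), (ren_form ren_sigma1 (fun j => j) g),
    (mix z w), V.
  intros n; rewrite (HP (scons n z)), (HQ (scons n z)).
  split; unfold sigma1; split; intros [k Hk]; exists k.
  1, 3: apply (sat_ren _ (mix_sigma1 k n z w) (fun j => eq_refl (V j))).
  3, 4: apply (sat_ren _ (mix_sigma1 k n z w) (fun j => eq_refl (V j))) in Hk.
  all: destruct (H (scons k (scons n z))); tauto.
Qed.

End Definability.

Existing Class RCA0.

(** * Arithmetic in a model of RCA_0 *)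

Section Arithmetic.

Context {M : L2_structure} {HM : RCA0 M}.

Notation env := (nat -> num M).

Let Hax : basic_axioms M := proj1 HM.

Lemma Sig_ind (P : num M -> Prop) :
  Sig (fun v => P (v O)) -> P 0 -> (forall n, P n -> P (n + 1)) -> forall n, P n.
Proof.
  intros HP H0 HS; destruct (Sig_formulas HP HP) as [f [g [w [V H]]]].
  intros n; apply H; revert n; apply (proj1 (proj2 HM)).
  - now apply H.
  - intros n Hn; apply H, HS; now apply H.
Qed.

Lemma Del_comprehension (P : num M -> Prop) :
  Del (fun v => P (v O)) -> exists X, forall n, mem n X <-> P n.
Proof.
  intros [HP HN]; destruct (Sig_formulas (Q := fun n => ~ P n) HP HN) as [f [g [w [V H]]]].
  destruct (proj2 (proj2 HM) f (fnot g) w V) as [X HX].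
  - intros n; rewrite <- (proj1 (H n)); split.
    + intros Hn k Hk; apply (proj2 (H n)); [now exists k | exact Hn].
    + intros Hk; apply NNPP; intros Hn; apply (proj2 (H n)) in Hn.
      destruct Hn as [k Hn]; exact (Hk k Hn).
  - exists X; intros n; rewrite HX; symmetry; apply H.
Qed.

Ltac tm := repeat first [apply Tm_const | apply Tm_var | apply Tm_add | apply Tm_mul].

Lemma equation_ind (t u : num M -> num M) :
  Tm (fun v => t (v O)) -> Tm (fun v => u (v O)) ->
  t 0 = u 0 -> (forall n, t n = u n -> t (n + 1) = u (n + 1)) ->
  forall n, t n = u n.
Proof.
  intros Ht Hu; apply (Sig_ind (P := fun n => t n = u n)).
  now apply Sig_D0, D0_eq.
Qed.

Ltac eqind n :=
  revert n;
  lazymatch goal with |- forall n, @?t n = @?u n =>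
    apply (@equation_ind t u); cbv beta; [tm | tm | | intros n IH]
  end.

Lemma add0n n : 0 + n = n :> num M.
Proof.
  eqind n; [apply (add_zero Hax)|].
  now rewrite (add_succ Hax), IH.
Qed.

Lemma addSn m n : (m + 1) + n = (m + n) + 1 :> num M.
Proof.
  eqind n; [now rewrite !(add_zero Hax)|].
  now rewrite !(add_succ Hax), IH.
Qed.

Lemma addC m n : m + n = n + m :> num M.
Proof.
  eqind n; [now rewrite (add_zero Hax), add0n|].
  now rewrite (add_succ Hax), addSn, IH.
Qed.

Lemma addA m n p : m + (n + p) = m + n + p :> num M.
Proof.
  eqind p; [now rewrite !(add_zero Hax)|].
  now rewrite !(add_succ Hax), IH.
Qed.

Lemma mul0n n : 0 * n = 0 :> num M.
Proof.
  eqind n; [apply (mul_zero Hax)|].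
  now rewrite (mul_succ Hax), IH, add0n.
Qed.

Lemma mulSn m n : (m + 1) * n = m * n + n :> num M.
Proof.
  eqind n; [now rewrite !(mul_zero Hax), add0n|].
  rewrite !(mul_succ Hax), IH.
  rewrite <- !addA; f_equal; rewrite !addA; f_equal; apply addC.
Qed.

Lemma mulC m n : m * n = n * m :> num M.
Proof.
  eqind n; [now rewrite (mul_zero Hax), mul0n|].
  now rewrite (mul_succ Hax), mulSn, IH.
Qed.

Lemma mulDl m n p : (m + n) * p = m * p + n * p :> num M.
Proof.
  eqind p; [now rewrite !(mul_zero Hax), add0n|].
  rewrite !(mul_succ Hax), IH.
  rewrite <- !addA; f_equal; rewrite !addA; f_equal; apply addC.
Qed.

Lemma mulA m n p : m * (n * p) = m * n * p :> num M.
Proof.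
  eqind p; [now rewrite !(mul_zero Hax)|].
  now rewrite !(mul_succ Hax), mulC, mulDl, (mulC (n * p)), IH, (mulC n m).
Qed.

Lemma mul1n n : 1 * n = n :> num M.
Proof.
  now rewrite <- (add0n 1), mulSn, mul0n, add0n.
Qed.

Lemma num_semiring : semi_ring_theory (@zero M) one add mul eq.
Proof.
  constructor; [exact add0n | exact addC | exact addA | exact mul1n | exact mul0n
    | exact mulC | exact mulA | exact mulDl].
Qed.

Add Ring num_ring : num_semiring.

Lemma addIn (m n p : num M) : m + p = n + p -> m = n.
Proof.
  revert p; apply (Sig_ind (P := fun p => m + p = n + p -> m = n)).
  - apply Sig_D0, D0_ext with (P := fun v => ~ m + v O = n + v O \/ m = n).
    { intros v; tauto. }
    apply D0_or; [apply D0_not|]; apply D0_eq; tm.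
  - now rewrite !(add_zero Hax).
  - intros p IH H; apply IH, (succ_inj Hax). now rewrite <- !(add_succ Hax).
Qed.

(** The axioms constrain [<] only through zero and successor; expressing it by addition reduces most
    later inequalities to [ring]. *)
Lemma lt_exists (m n : num M) : m < n <-> exists d, n = m + d + 1.
Proof.
  split.
  - revert n; apply (Sig_ind (P := fun n => m < n -> exists d, n = m + d + 1)).
    (* The existential is pulled out of the implication; when the premise fails, any [d] serves. *)
    + apply Sig_ext with (P := fun v => exists d, ~ m < v O \/ v O = m + d + 1).
      { intros v; split.
        - intros [d [H|H]]; [tauto | eauto].
        - intros H; destruct (classic (m < v O)) as [Hm|Hm];
            [destruct (H Hm) as [d Hd]; eauto | exists 0; auto]. }
      apply (Sig_ex0 (R := fun d v => ~ m < v O \/ v O = m + d + 1)).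
      apply D0_or; [apply D0_not, D0_lt | apply D0_eq]; tm.
    + intros H; destruct (not_lt_zero Hax H).
    + intros n IH H; apply (lt_succ Hax) in H; destruct H as [H| <-].
      * destruct (IH H) as [d ->]; exists (d + 1); ring.
      * exists 0; ring.
  - intros [d ->]; revert d; apply (Sig_ind (P := fun d => m < m + d + 1)).
    + apply Sig_D0, D0_lt; tm.
    + apply (lt_succ Hax); right; ring.
    + intros d IH; rewrite addA; apply (lt_succ Hax); now left.
Qed.

Definition le (m n : num M) : Prop := exists d, n = m + d.

Lemma zero_or_succ (n : num M) : n = 0 \/ exists m, n = m + 1.
Proof.
  revert n; apply (Sig_ind (P := fun n => n = 0 \/ exists m, n = m + 1)); eauto.
  apply Sig_ext with (P := fun v => exists m, v O = 0 \/ v O = m + 1).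
  { intros v; split; [intros [m [H|H]]; eauto|].
    intros [H|[m H]]; [exists 0|exists m]; auto. }
  apply (Sig_ex0 (R := fun m v => v O = 0 \/ v O = m + 1)).
  apply D0_or; apply D0_eq; tm.
Qed.

Lemma lt_le_succ m n : m < n <-> le (m + 1) n.
Proof.
  rewrite lt_exists; split; intros [d ->]; exists d; ring.
Qed.

Lemma lt_succ_le m n : m < n + 1 <-> le m n.
Proof.
  rewrite lt_exists; split; intros [d H]; exists d.
  - now apply (succ_inj Hax).
  - now rewrite H.
Qed.

Lemma le_refl n : le n n.
Proof. exists 0; ring. Qed.

Lemma le_trans m n p : le m n -> le n p -> le m p.
Proof. intros [d ->] [e ->]; exists (d + e); ring. Qed.

Lemma lt_le_weak m n : m < n -> le m n.
Proof. rewrite lt_exists; intros [d ->]; exists (d + 1); ring. Qed.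

Lemma le_lt_trans m n p : le m n -> n < p -> m < p.
Proof.
  rewrite !lt_exists; intros [d ->] [e ->]; exists (d + e); ring.
Qed.

Lemma lt_le_trans m n p : m < n -> le n p -> m < p.
Proof.
  rewrite !lt_exists; intros [d ->] [e ->]; exists (d + e); ring.
Qed.

Lemma lt_trans (m n p : num M) : m < n -> n < p -> m < p.
Proof. intros H; apply le_lt_trans, lt_le_weak, H. Qed.

Lemma lt_irrefl (n : num M) : ~ n < n.
Proof.
  rewrite lt_exists; intros [d H]; apply (@succ_neq0 _ Hax d), (@addIn _ _ n).
  rewrite add0n; rewrite H at 2; ring.
Qed.

Lemma lt_or_le m n : m < n \/ le n m.
Proof.
  revert n; apply (Sig_ind (P := fun n => m < n \/ le n m)).
  - apply Sig_ext with (P := fun v => exists d, m < v O \/ m = v O + d).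
    { intros v; split; [intros [d [H|H]]; [left|right; exists d]; auto|].
      intros [H|[d H]]; [exists 0|exists d]; auto. }
    apply (Sig_ex0 (R := fun d v => m < v O \/ m = v O + d)).
    apply D0_or; [apply D0_lt | apply D0_eq]; tm.
  - right; exists m; ring.
  - intros n [H|[d H]].
    + left; apply (lt_succ Hax); auto.
    + destruct (zero_or_succ d) as [->|[e ->]].
      * left; apply (lt_succ Hax); right; rewrite H; ring.
      * right; exists e; rewrite H; ring.
Qed.

Lemma not_lt_le m n : ~ m < n <-> le n m.
Proof.
  destruct (lt_or_le m n) as [H|H]; split; try tauto.
  - intros Hle; destruct (lt_irrefl (lt_le_trans H Hle)).
  - intros _ Hlt; exact (lt_irrefl (lt_le_trans Hlt H)).
Qed.

Lemma le_lt_eq m n : le m n <-> m < n \/ m = n.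
Proof. rewrite <- lt_succ_le; apply (lt_succ Hax). Qed.

Lemma le_antisym m n : le m n -> le n m -> m = n.
Proof.
  intros H1 H2; apply le_lt_eq in H1; destruct H1 as [H1|]; [|assumption].
  destruct (lt_irrefl (lt_le_trans H1 H2)).
Qed.

Lemma lt_trichotomy (m n : num M) : m < n \/ m = n \/ n < m.
Proof.
  destruct (lt_or_le m n) as [H|H]; auto.
  apply le_lt_eq in H; destruct H; auto.
Qed.

Lemma lt_succ_diag (n : num M) : n < n + 1.
Proof. apply lt_succ_le, le_refl. Qed.

Lemma le_addr m n : le m (m + n).
Proof. now exists n. Qed.

Lemma le_addl m n : le m (n + m).
Proof. exists n; ring. Qed.

Lemma le_add m n p q : le m n -> le p q -> le (m + p) (n + q).
Proof. intros [d ->] [e ->]; exists (d + e); ring. Qed.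

Lemma lt_add_le m n p q : m < n -> le p q -> m + p < n + q.
Proof.
  rewrite !lt_exists; intros [d ->] [e ->]; exists (d + e); ring.
Qed.

Lemma le_mul m n p q : le m n -> le p q -> le (m * p) (n * q).
Proof. intros [d ->] [e ->]; exists (d * p + m * e + d * e); ring. Qed.

Lemma zero_le n : le 0 n.
Proof. exists n; ring. Qed.

Lemma pos_neq0 (n : num M) : 0 < n <-> n <> 0.
Proof.
  split; [intros H ->; exact (lt_irrefl H)|].
  destruct (zero_or_succ n) as [->|[m ->]]; [tauto|].
  intros _; apply lt_succ_le, zero_le.
Qed.

Lemma le_mul_pos m n : n <> 0 -> le m (m * n).
Proof.
  destruct (zero_or_succ n) as [->|[p ->]]; [tauto|].
  intros _; exists (m * p); ring.
Qed.

Lemma mul_eq0 (m n : num M) : m * n = 0 -> m = 0 \/ n = 0.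
Proof.
  destruct (zero_or_succ n) as [->|[p ->]]; auto.
  intros H; left; apply le_antisym; [|apply zero_le].
  rewrite <- H; exists (m * p); ring.
Qed.

Lemma le_zero n : le n 0 -> n = 0.
Proof. intros H; apply le_antisym; [exact H | apply zero_le]. Qed.

End Arithmetic.

(** * Closure of Sigma^0_1 and Delta^0_1 predicates, collection, least elements *)

Ltac d0_tm := cbv beta; repeat first
  [ apply Tm_const | apply Tm_var | apply Tm_add | apply Tm_mul ].

Ltac d0 := cbv beta; repeat (first
  [ assumption | apply D0_bex; [d0_tm|] | apply D0_ball; [d0_tm|] | apply D0_and
  | apply D0_or | apply D0_not
  | apply D0_eq; d0_tm | apply D0_lt; d0_tm ]; cbv beta).

Section Closure.

Context {M : L2_structure} {HM : RCA0 M}.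

Notation env := (nat -> num M).

(** The single unbounded quantifier serves as a common bound for both witnesses, which avoids
    decoding pairs. *)
Lemma Sig_and P Q : Sig P -> Sig Q -> Sig (fun v : env => P v /\ Q v).
Proof.
  intros [P' [HP' HP]] [Q' [HQ' HQ]].
  apply Sig_ext with (P := fun v => exists k,
    (exists a, a < k /\ P' (scons a v)) /\ (exists b, b < k /\ Q' (scons b v))).
  - intros v; rewrite HP, HQ; split.
    + intros [k [[a [_ Ha]] [b [_ Hb]]]]; eauto.
    + intros [[a Ha] [b Hb]]; exists (a + b + 1); split; [exists a|exists b];
        (split; [apply lt_succ_le|assumption]); [apply le_addr|apply le_addl].
  - apply Sig_ex0; d0.
    + apply D0_sub with (r := scons O (fun i => S (S i))); [assumption|].
      now intros v [|i].
    + apply D0_sub with (r := scons O (fun i => S (S i))); [assumption|].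
      now intros v [|i].
Qed.

Lemma Sig_or P Q : Sig P -> Sig Q -> Sig (fun v : env => P v \/ Q v).
Proof.
  intros [P' [HP' HP]] [Q' [HQ' HQ]].
  apply Sig_ext with (P := fun v => exists k, P' (scons k v) \/ Q' (scons k v)).
  - intros v; rewrite HP, HQ; split.
    + intros [k [H|H]]; eauto.
    + intros [[k H]|[k H]]; eauto.
  - apply Sig_ex0; d0; (apply D0_sub with (r := fun i => i); [assumption|]);
      now intros v [|i].
Qed.

Lemma Sig_ex (R : num M -> env -> Prop) :
  Sig (fun v => R (v O) (tl v)) -> Sig (fun v => exists x, R x v).
Proof.
  intros [Q [HQ H]].
  apply Sig_ext with (P := fun v => exists k, exists x, x < k /\
    exists y, y < k /\ Q (scons y (scons x v))).
  - intros v; split.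
    + intros [k [x [_ [y [_ Hy]]]]]; exists x.
      apply (H (scons x v)); eauto.
    + intros [x Hx]; apply (H (scons x v)) in Hx; destruct Hx as [y Hy].
      exists (x + y + 1), x; split; [apply lt_succ_le, le_addr|].
      exists y; split; [apply lt_succ_le, le_addl|exact Hy].
  - apply Sig_ex0; d0.
    apply D0_sub with (r := scons O (scons 1%nat (fun i => S (S (S i)))));
      [assumption|]; now intros v [|[|i]].
Qed.

Lemma collection (Q : num M -> num M -> Prop) (b : num M) :
  D0 (fun v => Q (v O) (v 1%nat)) ->
  (forall x, x < b -> exists k, Q k x) ->
  exists K, forall x, x < b -> exists k, k < K /\ Q k x.
Proof.
  intros HQ Hb.
  (* The disjunct [~ x < b] lets the induction run over all [n], although witnesses are known only
     below [b]; the instance [n = b] is the claim. *)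
  assert (H : forall n, exists K, forall x, x < n ->
    exists k, k < K /\ (~ x < b \/ Q k x)).
  { apply (Sig_ind (P := fun n => exists K, forall x, x < n ->
      exists k, k < K /\ (~ x < b \/ Q k x))).
    - apply Sig_ex0; d0; exact HQ.
    - exists 0; intros x Hx; destruct (not_lt_zero (proj1 HM) Hx).
    - intros n [K HK].
      assert (Hn : exists k, ~ n < b \/ Q k n).
      { destruct (classic (n < b)) as [Hn|Hn]; [|exists 0; auto].
        destruct (Hb n Hn) as [k Hk]; eauto. }
      destruct Hn as [k Hk]; exists (K + k + 1); intros x Hx.
      apply lt_succ_le, le_lt_eq in Hx; destruct Hx as [Hx| ->].
      + destruct (HK x Hx) as [k' [Hk' Hx']]; exists k'; split; [|exact Hx'].
        apply lt_succ_le; apply le_trans with K; [now apply lt_le_weak|apply le_addr].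
      + exists k; split; [apply lt_succ_le, le_addl|exact Hk]. }
  destruct (H b) as [K HK]; exists K; intros x Hx.
  destruct (HK x Hx) as [k [Hk [Hn|Hx']]]; [tauto|eauto].
Qed.

Lemma Sig_ball_var (R : num M -> env -> Prop) (i : nat) :
  Sig (fun v => R (v O) (tl v)) -> Sig (fun v => forall x, x < v i -> R x v).
Proof.
  intros [Q [HQ H]].
  apply Sig_ext with (P := fun v => exists K, forall x, x < v i ->
    exists k, k < K /\ Q (scons k (scons x v))).
  - intros v; split.
    + intros [K HK] x Hx; destruct (HK x Hx) as [k [_ Hk]].
      apply (H (scons x v)); eauto.
    + intros Hv; apply (collection (Q := fun k x => Q (scons k (scons x v)))).
      (* Collection concerns a binary relation on numbers, so every other variable is frozen at its
         value in [v]. *)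
      * apply D0_inst with (s := scons (inl O) (scons (inl 1%nat) (fun i => inr (v i))));
          [exact HQ|]; now intros w [|[|j]].
      * intros x Hx; apply (H (scons x v)), Hv, Hx.
  - apply Sig_ex0; d0.
    apply D0_sub with (r := scons O (scons 1%nat (fun i => S (S (S i)))));
      [exact HQ|]; now intros v [|[|j]].
Qed.

Lemma Sig_ren (r : nat -> nat) P :
  Sig P -> Sig (fun v : env => P (fun i => v (r i))).
Proof.
  intros [Q [HQ H]]; exists (fun v => Q (scons (v O) (fun i => v (S (r i))))); split.
  - apply D0_sub with (r := scons O (fun i => S (r i))); [exact HQ|].
    now intros v [|i].
  - intros v; apply H.
Qed.

Lemma Fn_Tm t : Tm t -> Fn (M := M) t.
Proof.
  intros Ht; apply Sig_D0, D0_eq; [apply Tm_var | now apply (Tm_ren S)].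
Qed.

Lemma Fn_var i : Fn (fun v : env => v i).
Proof. apply Fn_Tm, Tm_var. Qed.

Lemma Fn_const (c : num M) : Fn (fun _ => c).
Proof. apply Fn_Tm, Tm_const. Qed.

Lemma Fn_ren (r : nat -> nat) t : Fn t -> Fn (fun v : env => t (fun i => v (r i))).
Proof. intros Ht; exact (Sig_ren (scons O (fun i => S (r i))) Ht). Qed.

Lemma Sig_subst (R : num M -> env -> Prop) t :
  Fn t -> Sig (fun v => R (v O) (tl v)) -> Sig (fun v => R (t v) v).
Proof.
  intros Ht HR; apply Sig_ext with (P := fun v => exists x, x = t v /\ R x v).
  - intros v; split; [intros [x [-> Hx]]; exact Hx | eauto].
  - apply Sig_ex, Sig_and; [exact Ht | exact HR].
Qed.

Lemma Fn_subst (f : num M -> env -> num M) t :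
  Fn t -> Fn (fun v => f (v O) (tl v)) -> Fn (fun v => f (t v) v).
Proof.
  intros Ht Hf; unfold Fn.
  apply (Sig_subst (R := fun x v => v O = f x (tl v)) (t := fun v => t (tl v))).
  - now apply Fn_ren.
  - exact (Sig_ren (scons 1%nat (scons O (fun i => S (S i)))) Hf).
Qed.

Lemma Fn_op2 (op : num M -> num M -> num M) t u :
  Fn (fun v => op (v O) (v 1%nat)) -> Fn t -> Fn u -> Fn (fun v => op (t v) (u v)).
Proof.
  intros Hop Ht Hu.
  apply (Fn_subst (f := fun x v => op x (u v)) Ht).
  apply (Fn_subst (f := fun y v => op (v O) y) (t := fun v => u (tl v))).
  - now apply Fn_ren.
  - exact (Fn_ren (scons 1%nat (scons O (fun i => i))) Hop).
Qed.

Lemma Fn_add t u : Fn t -> Fn u -> Fn (fun v : env => t v + u v).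
Proof. apply Fn_op2, Fn_Tm, Tm_add; apply Tm_var. Qed.

Lemma Fn_mul t u : Fn t -> Fn u -> Fn (fun v : env => t v * u v).
Proof. apply Fn_op2, Fn_Tm, Tm_mul; apply Tm_var. Qed.

Lemma Fn_npair t u : Fn t -> Fn u -> Fn (fun v : env => npair (t v) (u v)).
Proof.
  intros Ht Hu; unfold npair; apply Fn_add; [apply Fn_mul; apply Fn_add|];
    assumption.
Qed.

Lemma Sig_ball (R : num M -> env -> Prop) t :
  Fn t -> Sig (fun v => R (v O) (tl v)) -> Sig (fun v => forall x, x < t v -> R x v).
Proof.
  intros Ht HR; apply (Sig_subst (R := fun b v => forall x, x < b -> R x v) Ht).
  apply (@Sig_ball_var (fun x v => R x (tl v)) O).
  exact (Sig_ren (scons O (fun i => S (S i))) HR).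
Qed.

Lemma Del_Sig P : Del P -> Sig (M := M) P.
Proof. exact (@proj1 _ _). Qed.

Lemma Del_D0 P : D0 P -> Del (M := M) P.
Proof. intros H; split; apply Sig_D0; [|apply D0_not]; exact H. Qed.

Lemma Del_ext P Q : (forall v, P v <-> Q v) -> Del P -> Del (M := M) Q.
Proof.
  intros H [HP HN]; split; [apply Sig_ext with P | apply Sig_ext with (fun v => ~ P v)];
    try assumption; intros v; now rewrite H.
Qed.

Lemma Del_ren (r : nat -> nat) P :
  Del P -> Del (fun v : env => P (fun i => v (r i))).
Proof.
  intros [HP HN]; split; [exact (Sig_ren r HP) | exact (Sig_ren r HN)].
Qed.

Lemma Del_not P : Del P -> Del (fun v : env => ~ P v).
Proof.
  intros [HP HN]; split; [exact HN|].
  apply Sig_ext with P; [intros v; split; [tauto|apply NNPP] | exact HP].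
Qed.

Lemma Del_and P Q : Del P -> Del Q -> Del (fun v : env => P v /\ Q v).
Proof.
  intros [HP HP'] [HQ HQ']; split; [now apply Sig_and|].
  apply Sig_ext with (fun v => ~ P v \/ ~ Q v); [|now apply Sig_or].
  intros v; split; [tauto | apply not_and_or].
Qed.

Lemma Del_or P Q : Del P -> Del Q -> Del (fun v : env => P v \/ Q v).
Proof.
  intros [HP HP'] [HQ HQ']; split; [now apply Sig_or|].
  apply Sig_ext with (fun v => ~ P v /\ ~ Q v); [intros v; tauto|now apply Sig_and].
Qed.

Lemma Del_imp P Q : Del P -> Del Q -> Del (fun v : env => P v -> Q v).
Proof.
  intros HP HQ; apply Del_ext with (fun v => ~ P v \/ Q v).
  - intros v; split; [tauto | apply imply_to_or].
  - apply Del_or; [apply Del_not|]; assumption.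
Qed.

Lemma Del_iff P Q : Del P -> Del Q -> Del (fun v : env => P v <-> Q v).
Proof. intros HP HQ; apply Del_and; now apply Del_imp. Qed.

Lemma Del_bex (R : num M -> env -> Prop) t :
  Fn t -> Del (fun v => R (v O) (tl v)) -> Del (fun v => exists x, x < t v /\ R x v).
Proof.
  intros Ht [HR HN]; split.
  - apply Sig_ex, Sig_and; [|exact HR].
    apply (Sig_subst (R := fun b v => v O < b) (t := fun v => t (tl v)));
      [now apply Fn_ren | apply Sig_D0, D0_lt; apply Tm_var].
  - apply Sig_ext with (fun v => forall x, x < t v -> ~ R x v).
    + intros v; firstorder.
    + now apply Sig_ball.
Qed.

Lemma Del_ball (R : num M -> env -> Prop) t :
  Fn t -> Del (fun v => R (v O) (tl v)) -> Del (fun v => forall x, x < t v -> R x v).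
Proof.
  intros Ht HR; apply Del_ext with (fun v => ~ exists x, x < t v /\ ~ R x v).
  - intros v; split; [|firstorder].
    intros H x Hx; apply NNPP; eauto.
  - apply Del_not, (Del_bex (R := fun x v => ~ R x v)); [|apply Del_not]; assumption.
Qed.

Lemma Del_ex (R : num M -> env -> Prop) t :
  Fn t -> (forall v x, R x v -> x < t v) -> Del (fun v => R (v O) (tl v)) ->
  Del (fun v => exists x, R x v).
Proof.
  intros Ht Hb HR; apply Del_ext with (fun v => exists x, x < t v /\ R x v).
  - intros v; split; [firstorder|]; intros [x Hx]; eauto.
  - now apply Del_bex.
Qed.

Lemma Del_subst (R : num M -> env -> Prop) t :
  Fn t -> Del (fun v => R (v O) (tl v)) -> Del (fun v => R (t v) v).
Proof.
  intros Ht [HR HN]; split; [exact (Sig_subst Ht HR)|].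
  exact (Sig_subst (R := fun x v => ~ R x v) Ht HN).
Qed.

Lemma Del_rel1 (R : num M -> Prop) t :
  Del (fun v => R (v O)) -> Fn t -> Del (fun v => R (t v)).
Proof. intros HR Ht; exact (Del_subst (R := fun x _ => R x) Ht HR). Qed.

Lemma Del_rel2 (R : num M -> num M -> Prop) t u :
  Del (fun v => R (v O) (v 1%nat)) -> Fn t -> Fn u -> Del (fun v => R (t v) (u v)).
Proof.
  intros HR Ht Hu; apply (Del_subst (R := fun x v => R x (u v)) Ht).
  apply (Del_subst (R := fun y v => R (v O) y) (t := fun v => u (tl v))).
  - now apply Fn_ren.
  - exact (Del_ren (scons 1%nat (scons O (fun i => i))) HR).
Qed.

Lemma Del_eq t u : Fn t -> Fn u -> Del (fun v : env => t v = u v).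
Proof. apply Del_rel2, Del_D0, D0_eq; apply Tm_var. Qed.

Lemma Del_lt t u : Fn t -> Fn u -> Del (fun v : env => t v < u v).
Proof. apply Del_rel2, Del_D0, D0_lt; apply Tm_var. Qed.

Lemma Del_mem t X : Fn t -> Del (fun v : env => mem (t v) X).
Proof. apply (Del_rel1 (R := fun x => mem x X)), Del_D0, D0_mem, Tm_var. Qed.

Lemma Sig_imp P Q : Del P -> Sig Q -> Sig (fun v : env => P v -> Q v).
Proof.
  intros [_ HN] HQ; apply Sig_ext with (fun v => ~ P v \/ Q v).
  - intros v; split; [tauto | apply imply_to_or].
  - now apply Sig_or.
Qed.

(** Without a least element, having no element below [b] would pass from [b] to [b + 1]. That
    property is Sigma^0_1 because collection absorbs its bounded quantifier. *)
Lemma least_element (P : num M -> Prop) :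
  Del (fun v => P (v O)) -> (exists n, P n) ->
  exists n, P n /\ forall m, m < n -> ~ P m.
Proof.
  intros HP [n Hn]; apply NNPP; intros Hc.
  assert (H : forall b m, m < b -> ~ P m).
  { apply (Sig_ind (P := fun b => forall m, m < b -> ~ P m)).
    - apply Sig_ball; [apply Fn_var|]; apply Del_Sig, Del_not.
      exact (Del_rel1 HP (Fn_var O)).
    - intros m Hm; destruct (not_lt_zero (proj1 HM) Hm).
    - intros b IH m Hm; apply lt_succ_le, le_lt_eq in Hm.
      destruct Hm as [Hm| ->]; [now apply IH|].
      intros HPb; apply Hc; eauto. }
  exact (H (n + 1) n (lt_succ_diag n) Hn).
Qed.

End Closure.

Ltac fn := cbv beta; repeat (first
  [ assumption | apply Fn_const | apply Fn_var | apply Fn_npair | apply Fn_add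
  | apply Fn_mul | (apply Fn_ren; assumption) ]; cbv beta).

Ltac del_with tac := cbv beta; repeat (first
  [ assumption | solve [tac] | apply Del_bex; [fn|] | apply Del_ball; [fn|]
  | apply Del_iff | apply Del_and | apply Del_or | apply Del_not | apply Del_imp
  | apply Del_eq; fn | apply Del_lt; fn | apply Del_mem; fn ]; cbv beta).

(** * Codes of finite sets *)

Section Codes.

Context {M : L2_structure} {HM : RCA0 M}.

Notation env := (nat -> num M).

Add Ring num_ring : (@num_semiring M HM).

Lemma not_lt0 (n : num M) : ~ n < 0.
Proof. apply (not_lt_zero (proj1 HM)). Qed.

Lemma lt_succ_cases (m n : num M) : m < n + 1 -> m < n \/ m = n.
Proof. apply (lt_succ (proj1 HM)). Qed.

Definition dvd (a b : num M) : Prop := exists d, b = d * a.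

Lemma Del_dvd t u : Fn t -> Fn u -> Del (fun v : env => dvd (t v) (u v)).
Proof.
  intros Ht Hu; apply Del_ext with (fun v => exists d, d < u v + 1 /\ u v = d * t v).
  - intros v; split; [intros [d [_ H]]; exists d; exact H|].
    (* A nonzero divisor bounds the quotient by the dividend. For divisor 0 every quotient works, so
       0 is taken. *)
    intros [d H]; destruct (classic (t v = 0)) as [E|E].
    + exists 0; split; [apply lt_succ_le, zero_le|]; rewrite H, E; ring.
    + exists d; split; [|exact H]; rewrite H; now apply lt_succ_le, le_mul_pos.
  - del_with fail.
Qed.

Lemma dvd_mulr (a b c : num M) : dvd a b -> dvd a (b * c).
Proof. intros [d ->]; exists (d * c); ring. Qed.

Lemma dvd_mull (a b c : num M) : dvd a b -> dvd a (c * b).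
Proof. intros [d ->]; exists (c * d); ring. Qed.

Lemma dvd_refl (a : num M) : dvd a a.
Proof. exists 1; ring. Qed.

Lemma dvd_add (a b c : num M) : dvd a b -> dvd a c -> dvd a (b + c).
Proof. intros [d ->] [e ->]; exists (d + e); ring. Qed.

Lemma addnI (m n p : num M) : p + m = p + n -> m = n.
Proof. rewrite !(addC p); apply addIn. Qed.

Lemma dvd_addr (a b c : num M) : dvd a b -> dvd a (b + c) -> dvd a c.
Proof.
  intros [d ->] [e H]; destruct (classic (a = 0)) as [->|Ha].
  { exists e; rewrite <- H; ring. }
  destruct (lt_or_le e d) as [Hlt|[k ->]].
  (* There is no subtraction; if the quotient of the sum is the smaller one, then [(k + 1) * a + c]
     vanishes and [c] is 0. *)
  - apply lt_exists in Hlt; destruct Hlt as [k ->].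
    assert (H0 : (k + 1) * a + c = 0)
      by (apply (addnI (p := e * a)); rewrite addA, <- mulDl, addA, H; ring).
    exists 0; rewrite mul0n; apply le_zero; rewrite <- H0; apply le_addl.
  - exists k; apply (addnI (p := d * a)); rewrite H; ring.
Qed.

(** Induction on the mere existence of a multiple takes the place of a recursively defined product.
    It supplies first the base [m] of the moduli and then the common multiple [N] of the moduli
    themselves. *)
Lemma common_multiple (f : num M -> num M) (K : num M) :
  Fn (fun v => f (v O)) -> (forall i, f i <> 0) ->
  exists N, N <> 0 /\ forall i, i < K -> dvd (f i) N.
Proof.
  intros Hf Hpos; revert K.
  apply (Sig_ind (P := fun K => exists N, N <> 0 /\ forall i, i < K -> dvd (f i) N)).
  - apply Sig_ex, Del_Sig.
    del_with ltac:(apply Del_dvd; [exact (Fn_subst (f := fun x _ => f x) (Fn_var O) Hf)|fn]).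
  - exists 1; split; [|intros i Hi; destruct (not_lt0 Hi)].
    rewrite <- (add0n 1); apply (succ_neq0 (proj1 HM)).
  - intros K [N [HN H]]; exists (N * f K); split.
    + intros E; apply mul_eq0 in E; destruct E as [E|E]; [tauto|exact (Hpos K E)].
    + intros i Hi; apply lt_succ_cases in Hi; destruct Hi as [Hi| ->].
      * now apply dvd_mulr, H.
      * apply dvd_mull, dvd_refl.
Qed.

Lemma remainder (n N : num M) : N <> 0 -> exists q r, n = q * N + r /\ r < N.
Proof.
  intros HN; revert n.
  apply (Sig_ind (P := fun n => exists q r, n = q * N + r /\ r < N)).
  - apply Sig_ex, Sig_ex, Del_Sig; del_with fail.
  - exists 0, 0; split; [ring | now apply pos_neq0].
  - intros n [q [r [-> Hr]]]; apply lt_le_succ, le_lt_eq in Hr; destruct Hr as [Hr|Hr].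
    + exists q, (r + 1); split; [ring|exact Hr].
    + exists (q + 1), 0; split; [rewrite <- Hr; ring | now apply pos_neq0].
Qed.

(* Goedel's beta function: the moduli [m * (i + 1) + 1] for [i < K] are pairwise
   coprime as soon as [m] is a multiple of all of [1, ..., K]. *)
Definition modulus (m i : num M) : num M := m * (i + 1) + 1.

Lemma modulus_neq0 m i : modulus m i <> 0.
Proof. apply (succ_neq0 (proj1 HM)). Qed.

(** [x * modulus m i] equals [x * m * (i + 1) + x], so [m] is invertible modulo [modulus m i]. *)
Lemma modulus_cancel m i x : dvd (modulus m i) (x * m) -> dvd (modulus m i) x.
Proof.
  intros H; apply (@dvd_addr _ (x * m * (i + 1))); [now apply dvd_mulr|].
  replace (x * m * (i + 1) + x) with (x * modulus m i) by (unfold modulus; ring).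
  apply dvd_mull, dvd_refl.
Qed.

(** The two moduli differ by [m * (e + 1)] with [e + 1] the distance between [i] and [j], and
    [e + 1] divides [m]. Completing [e + 1] to [m] allows both factors to be cancelled by
    [modulus_cancel]. *)
Lemma modulus_coprime m K i j x :
  (forall i, i < K -> dvd (i + 1) m) -> i < K -> j < K -> i <> j ->
  dvd (modulus m i) (x * modulus m j) -> dvd (modulus m i) x.
Proof.
  intros Hm Hi Hj Hij H.
  assert (Hdiff : forall e, dvd (e + 1) m -> dvd (modulus m i) (x * m * (e + 1)) ->
            dvd (modulus m i) x).
  { intros e [c Hc] He; apply modulus_cancel.
    rewrite Hc at 2; replace (x * (c * (e + 1))) with (x * (e + 1) * c) by ring.
    apply dvd_mulr, modulus_cancel.
    now replace (x * (e + 1) * m) with (x * m * (e + 1)) by ring. }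
  destruct (lt_trichotomy i j) as [Hlt|[Heq|Hlt]]; [|tauto|];
    apply lt_exists in Hlt; destruct Hlt as [e ->]; apply (Hdiff e).
  - apply Hm; apply le_lt_trans with (i + e + 1); [|exact Hj].
    exists (i + 1); ring.
  - apply (@dvd_addr _ (x * modulus m i)); [apply dvd_mull, dvd_refl|].
    replace (x * modulus m i + x * m * (e + 1)) with (x * modulus m (i + e + 1))
      by (unfold modulus; ring); exact H.
  - apply Hm; apply le_lt_trans with (j + e + 1); [|exact Hi].
    exists (j + 1); ring.
  - apply (@dvd_addr _ (x * modulus m j)); [exact H|].
    replace (x * modulus m j + x * m * (e + 1)) with (x * modulus m (j + e + 1))
      by (unfold modulus; ring); apply dvd_mull, dvd_refl.
Qed.

(** The number is the product of the moduli of the members, built one index at a time; coprimality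
    keeps the moduli of non-members from dividing it. *)
Lemma subset_product m K (P : num M -> Prop) :
  m <> 0 -> (forall i, i < K -> dvd (i + 1) m) -> Del (fun v => P (v O)) ->
  exists n, forall i, i < K -> (dvd (modulus m i) n <-> P i).
Proof.
  intros Hm0 Hm HP.
  assert (H : forall j, exists n, forall i, i < K ->
             (dvd (modulus m i) n <-> i < j /\ P i)).
  { apply (Sig_ind (P := fun j => exists n, forall i, i < K ->
             (dvd (modulus m i) n <-> i < j /\ P i))).
    - apply Sig_ex, Del_Sig; unfold modulus.
      del_with ltac:(first [apply Del_dvd; fn | apply (Del_rel1 HP); fn]).
    (* The empty product: each modulus exceeds 1 because [m] is nonzero. *)
    - exists 1; intros i Hi; split; [|intros [H _]; destruct (not_lt0 H)].
      intros H; exfalso.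
      destruct H as [d Hd]; apply (@lt_irrefl _ _ 1); rewrite Hd at 2.
      apply lt_le_trans with (modulus m i).
      + unfold modulus; apply lt_exists.
        destruct (zero_or_succ m) as [->|[p Hp]]; [tauto|].
        exists (p * (i + 1) + i); rewrite Hp; ring.
      + rewrite mulC; apply le_mul_pos; intros ->.
        apply (succ_neq0 (proj1 HM) (n := 0)); rewrite add0n, Hd; ring.
    - intros j [n Hn]; destruct (classic (P j /\ j < K)) as [[Hj HjK]|Hj].
      + exists (n * modulus m j); intros i Hi; split.
        * intros H; destruct (classic (i = j)) as [->|Hij]; [split; [apply lt_succ_diag|exact Hj]|].
          apply (modulus_coprime Hm Hi HjK Hij), Hn in H; [|exact Hi].
          destruct H as [H1 H2]; split; [|exact H2].
          now apply lt_trans with j, lt_succ_diag.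
        * intros [H1 H2]; apply lt_succ_cases in H1; destruct H1 as [H1| ->].
          -- apply dvd_mulr, Hn; auto.
          -- apply dvd_mull, dvd_refl.
      + exists n; intros i Hi; rewrite (Hn i Hi); split.
        * intros [H1 H2]; split; [|exact H2].
          now apply lt_trans with j, lt_succ_diag.
        * intros [H1 H2]; split; [|exact H2].
          apply lt_succ_cases in H1; destruct H1 as [H1| ->]; [exact H1|tauto]. }
  destruct (H K) as [n Hn]; exists n; intros i Hi; rewrite (Hn i Hi); tauto.
Qed.

Lemma le_npair_l (i j : num M) : le i (npair i j).
Proof. apply le_addl. Qed.

Lemma le_npair_r (i j : num M) : le j (npair i j).
Proof.
  unfold npair; destruct (classic (i + j = 0)) as [E|E].
  - rewrite E. replace j with (@zero M); [apply zero_le|].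
    symmetry; apply le_zero; rewrite <- E; apply le_addl.
  - apply le_trans with (i + j); [apply le_addl|].
    apply le_trans with ((i + j) * (i + j)); [now apply le_mul_pos|apply le_addr].
Qed.

Lemma npair_mono (i j i' j' : num M) :
  le i i' -> le j j' -> le (npair i j) (npair i' j').
Proof.
  intros Hi Hj; apply le_add; [apply le_mul; apply le_add|]; assumption.
Qed.

(** With [s = i + j], the code lies between the squares of [s] and [s + 1], so it determines [s].
    The explicit difference below is free of subtraction since twice [s] minus [i] is
    [i + j + j]. *)
Lemma npair_sum_lt (i j i' j' : num M) :
  i + j < i' + j' -> npair i j < npair i' j'.
Proof.
  rewrite lt_exists; intros [d H]; unfold npair; rewrite H.
  apply lt_exists; exists (i + j + j + (i + j) * (d + d) + d * d + d + d + i').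
  ring.
Qed.

Lemma npair_inj (i j i' j' : num M) :
  npair i j = npair i' j' -> i = i' /\ j = j'.
Proof.
  intros H; destruct (lt_trichotomy (i + j) (i' + j')) as [Hlt|[E|Hlt]].
  - apply npair_sum_lt in Hlt; rewrite H in Hlt; destruct (lt_irrefl Hlt).
  - unfold npair in H; rewrite E in H; apply addnI in H; subst i'.
    split; [reflexivity|]; now apply addnI in E.
  - apply npair_sum_lt in Hlt; rewrite H in Hlt; destruct (lt_irrefl Hlt).
Qed.

Lemma Del_is_triple t : Fn t -> Del (fun v : env => is_triple (t v)).
Proof.
  intros Ht; apply Del_ext with (fun v => exists k, k < t v + 1 /\
    exists m, m < t v + 1 /\ exists n, n < t v + 1 /\ t v = npair k (npair m n)).
  - intros v; split.
    + intros [k [_ [m [_ [n [_ H]]]]]]; exists k, m, n; exact H.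
    + intros [k [m [n H]]]; exists k; rewrite H; split; [apply lt_succ_le, le_npair_l|].
      exists m; split; [apply lt_succ_le|exists n; split; [apply lt_succ_le|reflexivity]];
        (eapply le_trans; [|apply le_npair_r]); [apply le_npair_l|apply le_npair_r].
  - del_with fail.
Qed.

Lemma elt_triple (i k m n : num M) :
  elt i (npair k (npair m n)) <-> i < k /\ dvd (modulus m i) n.
Proof.
  split.
  - intros [k' [m' [n' [E H]]]]; apply npair_inj in E; destruct E as [-> E].
    apply npair_inj in E; destruct E as [-> ->]; exact H.
  - intros H; exists k, m, n; split; [reflexivity|exact H].
Qed.

Lemma elt_lt (i s : num M) : elt i s -> i < s.
Proof.
  intros [k [m [n [-> [H _]]]]]; apply lt_le_trans with k; [exact H|apply le_npair_l].
Qed.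

Lemma Del_elt t u : Fn t -> Fn u -> Del (fun v : env => elt (t v) (u v)).
Proof.
  intros Ht Hu; apply Del_ext with (fun v => exists k, k < u v + 1 /\
    exists m, m < u v + 1 /\ exists n, n < u v + 1 /\ u v = npair k (npair m n) /\
    t v < k /\ dvd (m * (t v + 1) + 1) n).
  - intros v; split.
    + intros [k [_ [m [_ [n [_ H]]]]]]; exists k, m, n; exact H.
    + intros [k [m [n H]]]; exists k; rewrite (proj1 H); split;
        [apply lt_succ_le, le_npair_l|].
      exists m; split; [apply lt_succ_le|exists n; split; [apply lt_succ_le|]].
      3: split; [reflexivity|exact (proj2 H)].
      all: eapply le_trans; [|apply le_npair_r].
      * apply le_npair_l.
      * apply le_npair_r.
  - del_with ltac:(apply Del_dvd; fn).
Qed.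

Lemma elt_iff_bounded (s t : num M) :
  (forall i, elt i t <-> elt i s) <-> (forall i, i < s + t -> (elt i t <-> elt i s)).
Proof.
  split; [auto|]; intros H i; split; intros Hi; apply H; try exact Hi;
    apply elt_lt in Hi; (eapply lt_le_trans; [exact Hi|]); [apply le_addl|apply le_addr].
Qed.

Lemma Del_same_elts t u : Fn t -> Fn u ->
  Del (fun v : env => forall i, elt i (t v) <-> elt i (u v)).
Proof.
  intros Ht Hu; eapply Del_ext; [intros v; symmetry; apply elt_iff_bounded|].
  del_with ltac:(apply Del_elt; fn).
Qed.

Lemma Del_finset_code t : Fn t -> Del (fun v : env => finset_code (t v)).
Proof.
  intros Ht; apply Del_ext with (fun v => is_triple (t v) /\
    forall u, u < t v -> ~ (is_triple u /\ forall i, elt i u <-> elt i (t v))).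
  - intros v; unfold finset_code; split; intros [H1 H2]; (split; [exact H1|]).
    + intros u Hu1 Hu2 Hu; exact (H2 u Hu (conj Hu1 Hu2)).
    + intros u Hu [Hu1 Hu2]; exact (H2 u Hu1 Hu2 Hu).
  - del_with ltac:(first [apply Del_is_triple; fn | apply Del_same_elts; fn]).
Qed.

Lemma finset_code_ext (s t : num M) :
  finset_code s -> finset_code t -> (forall i, elt i s <-> elt i t) -> s = t.
Proof.
  intros [Hs1 Hs2] [Ht1 Ht2] H; apply le_antisym; apply not_lt_le.
  - apply Hs2; [exact Ht1|]; intros i; symmetry; apply H.
  - apply Ht2; [exact Hs1|]; exact H.
Qed.

Lemma finset_code_exists (s : num M) :
  is_triple s -> exists t, finset_code t /\ le t s /\ forall i, elt i t <-> elt i s.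
Proof.
  intros Hs.
  destruct (@least_element _ _ (fun t => is_triple t /\ forall i, elt i t <-> elt i s))
    as [t [[Ht1 Ht2] Hmin]].
  - del_with ltac:(first [apply Del_is_triple; fn | apply Del_same_elts; fn]).
  - exists s; split; [exact Hs|reflexivity].
  - exists t; split; [split; [exact Ht1|]|split; [|exact Ht2]].
    + intros u Hu1 Hu2 Hlt; apply (Hmin u Hlt); split; [exact Hu1|].
      intros i; rewrite Hu2; apply Ht2.
    + apply not_lt_le; intros Hlt; apply (Hmin s Hlt); split; [exact Hs|reflexivity].
Qed.

(* [B] bounds the codes of all subsets of [[0, K)]: reducing the product of
   moduli modulo a common multiple [N] does not change which moduli divide it. *)
Definition code_bound (K B : num M) : Prop :=
  exists m N, m <> 0 /\ N <> 0 /\ (forall i, i < K -> dvd (i + 1) m) /\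
    (forall i, i < K -> dvd (modulus m i) N) /\ B = npair K (npair m N).

Lemma Sig_code_bound t u : Fn t -> Fn u -> Sig (fun v : env => code_bound (t v) (u v)).
Proof.
  intros Ht Hu; apply Sig_ex, Sig_ex, Del_Sig; unfold modulus.
  del_with ltac:(apply Del_dvd; fn).
Qed.

Lemma code_bound_exists (K : num M) : exists B, code_bound K B.
Proof.
  destruct (@common_multiple (fun i => i + 1) K) as [m [Hm0 Hm]].
  { fn. }
  { intros i; apply (succ_neq0 (proj1 HM)). }
  destruct (@common_multiple (modulus m) K) as [N [HN0 HN]].
  { unfold modulus; fn. }
  { apply modulus_neq0. }
  exists (npair K (npair m N)), m, N; auto.
Qed.

Lemma bounded_code (K B : num M) (P : num M -> Prop) :
  code_bound K B -> Del (fun v => P (v O)) ->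
  exists s, finset_code s /\ s < B /\ forall i, elt i s <-> i < K /\ P i.
Proof.
  intros [m [N [Hm0 [HN0 [Hm [HN ->]]]]]] HP.
  destruct (subset_product Hm0 Hm HP) as [n Hn].
  destruct (remainder n HN0) as [q [r [E Hr]]].
  destruct (@finset_code_exists (npair K (npair m r))) as [s [Hs1 [Hs2 Hs3]]].
  { now exists K, m, r. }
  exists s; split; [exact Hs1|split].
  - apply le_lt_trans with (1 := Hs2); apply npair_sum_lt; rewrite !(addC K).
    apply lt_add_le; [|apply le_refl]; apply npair_sum_lt; rewrite !(addC m).
    apply lt_add_le; [exact Hr|apply le_refl].
  - intros i; rewrite Hs3, elt_triple; split; intros [Hi H]; (split; [exact Hi|]).
    + apply Hn; [exact Hi|]; rewrite E; apply dvd_add; [|exact H].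
      now apply dvd_mull, HN.
    + apply (@dvd_addr _ (q * N)); [now apply dvd_mull, HN|].
      rewrite <- E; now apply Hn.
Qed.

(** Canonical codes are unique, so [s] is the code that [bounded_code] yields below [B]. This bounds
    quantifiers over all binary sequences of a given length. *)
Lemma code_lt_bound (K B s : num M) :
  code_bound K B -> finset_code s -> (forall i, elt i s -> i < K) -> s < B.
Proof.
  intros HB Hs HK; destruct (bounded_code (P := fun i => elt i s) HB) as [t [Ht1 [Ht2 Ht3]]].
  - apply Del_elt; fn.
  - replace s with t; [exact Ht2|]; apply finset_code_ext; auto.
    intros i; rewrite Ht3; split; [tauto|auto].
Qed.

Lemma bounded_comprehension (K : num M) (P : num M -> Prop) :
  Del (fun v => P (v O)) ->
  exists s, finset_code s /\ forall i, elt i s <-> i < K /\ P i.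
Proof.
  intros HP; destruct (code_bound_exists K) as [B HB].
  destruct (bounded_code HB HP) as [s [H1 [_ H2]]]; eauto.
Qed.

End Codes.

(** * Finite sequences *)

Section Sequences.

Context {M : L2_structure} {HM : RCA0 M}.

Notation env := (nat -> num M).

Lemma zero_neq_one : @zero M <> 1.
Proof. rewrite <- (add0n 1); intros H; exact (succ_neq0 (proj1 HM) (eq_sym H)). Qed.

Lemma elt_pair_lt (i x s : num M) : elt (npair i x) s -> i < s /\ x < s.
Proof.
  intros H; apply elt_lt in H; split; (eapply le_lt_trans; [|exact H]);
    [apply le_npair_l | apply le_npair_r].
Qed.

Lemma Del_finseq t u : Fn t -> Fn u -> Del (fun v : env => finseq (t v) (u v)).
Proof.
  intros Ht Hu; apply Del_ext with (fun v => finset_code (t v) /\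
    (forall w, w < t v -> elt w (t v) ->
       exists i, i < w + 1 /\ exists x, x < w + 1 /\ w = npair i x /\ i < u v) /\
    (forall i, i < u v -> exists x, x < t v /\ elt (npair i x) (t v) /\
       forall y, y < t v -> elt (npair i y) (t v) -> x = y)).
  - intros v; unfold finseq; split; intros [H1 [H2 H3]]; (split; [exact H1|split]).
    + intros w Hw; destruct (H2 w (elt_lt Hw) Hw) as [i [_ [x [_ H]]]]; eauto.
    + intros i Hi; destruct (H3 i Hi) as [x [_ [Hx H]]]; exists x; split; [exact Hx|].
      intros y Hy; exact (H y (proj2 (elt_pair_lt Hy)) Hy).
    + intros w _ Hw; destruct (H2 w Hw) as [i [x [-> H]]].
      exists i; split; [apply lt_succ_le, le_npair_l|].
      exists x; split; [apply lt_succ_le, le_npair_r|auto].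
    + intros i Hi; destruct (H3 i Hi) as [x [Hx H]]; exists x.
      split; [exact (proj2 (elt_pair_lt Hx))|split; [exact Hx|]].
      intros y _ Hy; exact (H y Hy).
  - del_with ltac:(first [apply Del_finset_code; fn | apply Del_elt; fn]).
Qed.

Lemma Del_binseq t u : Fn t -> Fn u -> Del (fun v : env => binseq (t v) (u v)).
Proof.
  intros Ht Hu; apply Del_ext with (fun v => finseq (t v) (u v) /\
    forall i, i < t v -> forall x, x < t v -> elt (npair i x) (t v) -> x = 0 \/ x = 1).
  - intros v; unfold binseq; split; intros [H1 H2]; (split; [exact H1|]).
    + intros i x H; destruct (elt_pair_lt H) as [Hi Hx]; exact (H2 i Hi x Hx H).
    + intros i _ x _; apply H2.
  - del_with ltac:(first [apply Del_finseq; fn | apply Del_elt; fn]).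
Qed.

(** For codes of finite sequences, this is the initial segment relation. *)
Definition sub_code (s t : num M) : Prop := forall w, elt w s -> elt w t.

Lemma Del_sub_code t u : Fn t -> Fn u -> Del (fun v : env => sub_code (t v) (u v)).
Proof.
  intros Ht Hu; apply Del_ext with (fun v => forall w, w < t v -> elt w (t v) -> elt w (u v)).
  - intros v; split; [intros H w Hw; exact (H w (elt_lt Hw) Hw)|intros H w _; apply H].
  - del_with ltac:(apply Del_elt; fn).
Qed.

Lemma finseq_value (s l i : num M) : finseq s l -> i < l -> exists x, elt (npair i x) s.
Proof. intros [_ [_ H]] Hi; destruct (H i Hi) as [x [Hx _]]; eauto. Qed.

Lemma finseq_index (s l i x : num M) : finseq s l -> elt (npair i x) s -> i < l.
Proof.
  intros [_ [H _]] Hi; destruct (H _ Hi) as [i' [x' [E Hi']]].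
  apply npair_inj in E; now destruct E as [-> _].
Qed.

Lemma finseq_functional (s l i x y : num M) :
  finseq s l -> elt (npair i x) s -> elt (npair i y) s -> x = y.
Proof.
  intros Hs Hx Hy; pose proof (finseq_index Hs Hx) as Hi.
  destruct Hs as [_ [_ H]]; destruct (H i Hi) as [z [_ Hz]].
  rewrite <- (Hz x Hx); exact (Hz y Hy).
Qed.

Lemma finseq_le (s l : num M) : finseq s l -> le l s.
Proof.
  intros Hs; destruct (zero_or_succ l) as [->|[k ->]]; [apply zero_le|].
  destruct (finseq_value Hs (lt_succ_diag k)) as [x Hx].
  now apply lt_le_succ, (elt_pair_lt Hx).
Qed.

Lemma finseq_length_le (s t l m : num M) :
  finseq s l -> finseq t m -> sub_code s t -> le l m.
Proof.
  intros Hs Ht Hst; apply not_lt_le; intros Hlt.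
  destruct (finseq_value Hs Hlt) as [x Hx].
  exact (lt_irrefl (finseq_index Ht (Hst _ Hx))).
Qed.

Lemma finseq_length (s l m : num M) : finseq s l -> finseq s m -> l = m.
Proof.
  intros Hl Hm; apply le_antisym; eapply finseq_length_le; eauto; now intros w.
Qed.

Lemma finseq_sub_eq (s t l : num M) : finseq s l -> finseq t l -> sub_code s t -> s = t.
Proof.
  intros Hs Ht Hst; apply finset_code_ext; [apply Hs | apply Ht|].
  intros w; split; [apply Hst|]; intros Hw.
  destruct (proj1 (proj2 Ht) w Hw) as [i [x [-> Hi]]].
  destruct (finseq_value Hs Hi) as [y Hy].
  now rewrite <- (finseq_functional Ht (Hst _ Hy) Hw).
Qed.

Lemma sub_code_pairs (s t l : num M) :
  finseq s l -> (forall i x, elt (npair i x) s -> elt (npair i x) t) -> sub_code s t.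
Proof.
  intros Hs H w Hw; destruct (proj1 (proj2 Hs) w Hw) as [i [x [-> _]]]; auto.
Qed.

Lemma finseq_restrict (t m n : num M) :
  finseq t m -> le n m ->
  exists u, finseq u n /\ sub_code u t /\
    forall i x, elt (npair i x) u <-> i < n /\ elt (npair i x) t.
Proof.
  intros Ht Hn.
  destruct (@bounded_comprehension _ _ t (fun w => elt w t /\
    exists i, i < w + 1 /\ exists x, x < w + 1 /\ w = npair i x /\ i < n))
    as [u [Hu1 Hu2]].
  { del_with ltac:(apply Del_elt; fn). }
  assert (Hsub : sub_code u t) by (intros w Hw; apply Hu2 in Hw; tauto).
  assert (Hval : forall i x, elt (npair i x) u <-> i < n /\ elt (npair i x) t).
  { intros i x; rewrite Hu2; split.
    - intros [_ [H [i' [_ [x' [_ [E Hi]]]]]]]; split; [|exact H].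
      apply npair_inj in E; now destruct E as [-> _].
    - intros [Hi H]; split; [exact (elt_lt H)|split; [exact H|]].
      exists i; split; [apply lt_succ_le, le_npair_l|].
      exists x; split; [apply lt_succ_le, le_npair_r|auto]. }
  exists u; split; [split; [exact Hu1|split]|split; assumption].
  - intros w Hw; apply Hu2 in Hw; destruct Hw as [_ [_ [i [_ [x [_ H]]]]]]; eauto.
  - intros i Hi; destruct (finseq_value Ht (lt_le_trans Hi Hn)) as [x Hx].
    exists x; split; [now apply Hval|]; intros y Hy; apply Hval in Hy.
    exact (finseq_functional Ht Hx (proj2 Hy)).
Qed.

Lemma binseq_exists (n : num M) (P : num M -> Prop) :
  Del (fun v => P (v O)) ->
  exists s, binseq s n /\ forall i, i < n ->
    (elt (npair i 1) s <-> P i) /\ (elt (npair i 0) s <-> ~ P i).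
Proof.
  intros HP.
  (* By monotonicity of pairing, [npair n 1] dominates every pair with first entry below [n] and
     second entry 0 or 1. *)
  destruct (@bounded_comprehension _ _ (npair n 1 + 1) (fun w => exists i, i < w + 1 /\
    exists x, x < w + 1 /\ w = npair i x /\ i < n /\ (x = 1 /\ P i \/ x = 0 /\ ~ P i)))
    as [s [Hs1 Hs2]].
  { del_with ltac:(apply (Del_rel1 HP); fn). }
  assert (Hval : forall i x, elt (npair i x) s <->
            i < n /\ (x = 1 /\ P i \/ x = 0 /\ ~ P i)).
  { intros i x; rewrite Hs2; split.
    - intros [_ [i' [_ [x' [_ [E H]]]]]].
      apply npair_inj in E; now destruct E as [-> ->].
    - intros [Hi H]; split.
      + apply lt_succ_le, npair_mono; [now apply lt_le_weak|].
        destruct H as [[-> _]|[-> _]]; [apply le_refl|apply zero_le].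
      + exists i; split; [apply lt_succ_le, le_npair_l|].
        exists x; split; [apply lt_succ_le, le_npair_r|auto]. }
  pose proof zero_neq_one as H01.
  exists s; split; [split; [split; [exact Hs1|split]|]|].
  - intros w Hw; apply Hs2 in Hw; destruct Hw as [_ [i [_ [x [_ H]]]]].
    exists i, x; tauto.
  - intros i Hi; destruct (classic (P i)) as [H|H]; [exists 1|exists 0];
      (split; [apply Hval; tauto|]); intros y Hy; apply Hval in Hy; intuition congruence.
  - intros i x H; apply Hval in H; tauto.
  - intros i Hi; rewrite !Hval; intuition congruence.
Qed.

Lemma binseq_value (s l i : num M) :
  binseq s l -> i < l -> (elt (npair i 0) s <-> ~ elt (npair i 1) s).
Proof.
  intros [Hs Hb] Hi; split.
  - intros H0 H1; exact (zero_neq_one (finseq_functional Hs H0 H1)).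
  - intros H; destruct (finseq_value Hs Hi) as [x Hx].
    destruct (Hb i x Hx) as [-> | ->]; [exact Hx|tauto].
Qed.

Lemma binseq_agree (s t l m i x : num M) :
  binseq s l -> binseq t m -> i < l -> i < m ->
  (elt (npair i 1) s <-> elt (npair i 1) t) ->
  elt (npair i x) s -> elt (npair i x) t.
Proof.
  intros Hs Ht Hl Hm H Hx; destruct (proj2 Hs i x Hx) as [-> | ->].
  - apply (binseq_value Ht Hm); rewrite <- H; now apply (binseq_value Hs Hl).
  - now apply H.
Qed.

Lemma binseq_sub (s t l m : num M) : binseq t m -> finseq s l -> sub_code s t -> binseq s l.
Proof.
  intros [_ Hb] Hs H; split; [exact Hs|]; intros i x Hx; exact (Hb i x (H _ Hx)).
Qed.

End Sequences.

(** * Weak Koenig's Lemma and separation *)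

Section Separation.

Context {M : L2_structure} {HM : RCA0 M}.

Notation env := (nat -> num M).

Definition Sigma1_separation : Prop :=
  forall A B : num M -> Prop,
    Sig (fun v => A (v O)) -> Sig (fun v => B (v O)) ->
    (forall n, A n -> B n -> False) ->
    exists X, (forall n, A n -> mem n X) /\ (forall n, B n -> ~ mem n X).

Lemma Sig_kernel (A : num M -> Prop) :
  Sig (fun v => A (v O)) ->
  exists alpha : num M -> num M -> Prop,
    Del (fun v => alpha (v O) (v 1%nat)) /\ forall n, A n <-> exists k, alpha k n.
Proof.
  intros [Q [HQ H]]; exists (fun k n => Q (scons k (scons n (fun _ => 0)))); split.
  - apply Del_D0, D0_inst with
      (s := scons (inl O) (scons (inl 1%nat) (fun _ => inr 0))); [exact HQ|].
    now intros v [|[|i]].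
  - intros n; apply (H (scons n (fun _ => 0))).
Qed.

(** A node is a finite guess at the separating set that no witness found so far refutes.
    Disjointness provides an unrefuted guess of every length. *)
Lemma WKL_separation : WKL M -> Sigma1_separation.
Proof.
  intros HW A B HA HB HAB.
  destruct (Sig_kernel HA) as [alpha [Ha HA']]; destruct (Sig_kernel HB) as [beta [Hb HB']].
  (* The length bounds positions and witnesses alike, which makes the condition decidable and
     inherited by initial segments. *)
  pose (ok s l := forall i, i < l -> forall k, k < l ->
    (alpha k i -> elt (npair i 1) s) /\ (beta k i -> elt (npair i 0) s)).
  destruct (@Del_comprehension _ _ (fun s => exists l, binseq s l /\ ok s l)) as [T HT].
  { apply Del_ex with (t := fun v => v O + 1); [fn| |].
    - intros v l [[Hl _] _]; apply lt_succ_le; exact (finseq_le Hl).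
    - unfold ok; del_with ltac:(first [apply Del_binseq; fn | apply Del_elt; fn
        | apply (Del_rel2 Ha); fn | apply (Del_rel2 Hb); fn]). }
  destruct (HW T) as [g [[Hg1 Hg2] Hg]].
  - split.
    + intros s Hs; apply HT in Hs; destruct Hs as [l [Hl _]]; eauto.
    + intros s t k Hs Ht Hsub; apply HT in Hs; destruct Hs as [l [Hl Hok]]; apply HT.
      assert (Ht' : binseq t k) by exact (binseq_sub Hl Ht Hsub).
      pose proof (finseq_length_le Ht (proj1 Hl) Hsub) as Hkl.
      assert (Hback : forall i x, i < k -> elt (npair i x) s -> elt (npair i x) t).
      { intros i x Hi Hx; destruct (finseq_value Ht Hi) as [y Hy].
        now rewrite (finseq_functional (proj1 Hl) Hx (Hsub _ Hy)). }
      exists k; split; [exact Ht'|]; intros i Hi j Hj.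
      destruct (Hok i (lt_le_trans Hi Hkl) j (lt_le_trans Hj Hkl)) as [H1 H0].
      split; intros H; apply Hback; auto.
  - intros n; destruct (@binseq_exists _ _ n (fun i => exists k, k < n /\ alpha k i))
      as [s [Hs1 Hs2]].
    { del_with ltac:(apply (Del_rel2 Ha); fn). }
    exists s; split; [|apply not_lt_le, finseq_le, Hs1].
    apply HT; exists n; split; [exact Hs1|]; intros i Hi k Hk.
    destruct (Hs2 i Hi) as [H1 H0]; split; intros H.
    + apply H1; eauto.
    + apply H0; intros [k' [_ Hk']]; apply (HAB i); [apply HA'|apply HB']; eauto.
  - assert (Hbit : forall i k, (alpha k i -> maps g i 1) /\ (beta k i -> maps g i 0)).
    (* Length [i + k + 1] covers both the position [i] and the witness [k]. *)
    { intros i k; destruct (Hg (i + k + 1)) as [s [HsT [Hs Hval]]].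
      apply HT in HsT; destruct HsT as [l [Hl Hok]].
      rewrite (finseq_length (proj1 Hl) Hs) in Hok.
      assert (Hi : i < i + k + 1) by (apply lt_succ_le, le_addr).
      assert (Hk : k < i + k + 1) by (apply lt_succ_le, le_addl).
      destruct (Hok i Hi k Hk) as [H1 H0].
      split; intros H; apply Hval; auto. }
    destruct (@Del_comprehension _ _ (fun n => maps g n 1)) as [X HX].
    { unfold maps; del_with fail. }
    exists X; split; intros n Hn; rewrite HX.
    + apply HA' in Hn; destruct Hn as [k Hk]; exact (proj1 (Hbit n k) Hk).
    + apply HB' in Hn; destruct Hn as [k Hk]; intros H1.
      destruct (Hg2 n I) as [x [_ Hx]]; apply zero_neq_one.
      rewrite <- (Hx _ H1); symmetry; apply Hx, (proj2 (Hbit n k) Hk).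
Qed.

End Separation.

(** * A path through an infinite binary tree from a separating set *)

Section Tree.

Context {M : L2_structure} {HM : RCA0 M}.

Notation env := (nat -> num M).

Context (T : sset M) (HT : binary_tree T).

(** For [s] of length [l], position [l] is the next one: the child of [s] with value [b] has a
    descendant on level [m], itself included. *)
Definition alive (m s l b : num M) : Prop :=
  exists t, mem t T /\ finseq t m /\ sub_code s t /\ elt (npair l b) t.

Lemma tree_bound (m B t : num M) :
  code_bound (npair m 1 + 1) B -> mem t T -> finseq t m -> t < B.
Proof.
  intros HB Ht Hm; apply (code_lt_bound HB); [apply Hm|].
  intros w Hw; destruct (proj1 (proj2 Hm) w Hw) as [i [x [-> Hi]]].
  apply lt_succ_le, npair_mono; [now apply lt_le_weak|].
  destruct (proj1 HT t Ht) as [l [_ Hb]].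
  destruct (Hb i x Hw) as [-> | ->]; [apply zero_le|apply le_refl].
Qed.

(** All nodes of level [m] lie below one code bound [B], so being dead is also Sigma^0_1: some such
    [B] has no suitable node below it. *)
Lemma Del_alive m s l b : Fn m -> Fn s -> Fn l -> Fn b ->
  Del (fun v : env => alive (m v) (s v) (l v) (b v)).
Proof.
  intros Hm Hs Hl Hb; split.
  - apply Sig_ex, Del_Sig.
    del_with ltac:(first [apply Del_finseq; fn | apply Del_elt; fn | apply Del_sub_code; fn]).
  - apply Sig_ext with (fun v => exists B, code_bound (npair (m v) 1 + 1) B /\
      forall t, t < B -> ~ (mem t T /\ finseq t (m v) /\ sub_code (s v) t /\
        elt (npair (l v) (b v)) t)).
    + intros v; split.
      * intros [B [HB H]] [t Ht]; apply (H t); [|exact Ht].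
        apply (tree_bound HB); apply Ht.
      * intros H; destruct (code_bound_exists (npair (m v) 1 + 1)) as [B HB].
        exists B; split; [exact HB|]; intros t _ Ht; apply H; exists t; exact Ht.
    + apply Sig_ex, Sig_and; [apply Sig_code_bound; fn|apply Del_Sig].
      del_with ltac:(first [apply Del_finseq; fn | apply Del_elt; fn | apply Del_sub_code; fn]).
Qed.

Lemma alive_anti m n s l b :
  finseq s l -> l < n -> le n m -> alive m s l b -> alive n s l b.
Proof.
  intros Hs Hln Hnm [t [HtT [Ht [Hst Hb]]]].
  destruct (finseq_restrict Ht Hnm) as [u [Hu [Hut Huval]]].
  exists u; split; [exact (proj2 HT t u n HtT Hu Hut)|split; [exact Hu|split]].
  - apply (sub_code_pairs Hs); intros i x Hx; apply Huval; split; [|exact (Hst _ Hx)].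
    exact (lt_trans (finseq_index Hs Hx) Hln).
  - now apply Huval.
Qed.

(** Finiteness of the subtree above one child is Sigma^0_1 too, but both subtrees may be finite;
    comparing the levels at which they end makes the two sets disjoint. *)
Definition dies_first (b c s : num M) : Prop :=
  exists m l, finseq s l /\ l < m /\ alive m s l c /\ ~ alive m s l b.

Lemma Sig_dies_first b c : Sig (fun v : env => dies_first b c (v O)).
Proof.
  apply Sig_ex, Sig_ex, Del_Sig.
  del_with ltac:(first [apply Del_finseq; fn | apply Del_alive; fn]).
Qed.

(** Aliveness decreases with the level: at the smaller of the two levels, one child would be both
    alive and dead. *)
Lemma dies_first_asym b c s : dies_first b c s -> dies_first c b s -> False.
Proof.
  intros [m [l [Hs [Hm [H1 H2]]]]] [m' [l' [Hs' [Hm' [H1' H2']]]]].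
  pose proof (finseq_length Hs' Hs); subst l'.
  destruct (lt_or_le m m') as [Hlt|Hle].
  - apply H2; apply (alive_anti Hs Hm (m := m')); [now apply lt_le_weak|exact H1'].
  - apply H2'; exact (alive_anti Hs Hm' Hle H1).
Qed.

Context (X : sset M)
  (HX1 : forall s, dies_first 0 1 s -> mem s X)
  (HX0 : forall s, dies_first 1 0 s -> ~ mem s X)
  (HTinf : infinite T).

(** A history of the recursion that turns to 1 at [u] exactly when [u] belongs to [X]. As a coded
    object, it can be shown to exist by Sigma^0_1 induction. *)
Definition guided (s n : num M) : Prop :=
  binseq s n /\ forall i, i < n -> exists u, finseq u i /\ sub_code u s /\
    (elt (npair i 1) s <-> mem u X).

Lemma Sig_guided t u : Fn t -> Fn u -> Sig (fun v : env => guided (t v) (u v)).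
Proof.
  intros Ht Hu; apply Sig_and; [apply Del_Sig, Del_binseq; fn|].
  apply Sig_ball; [fn|]; apply Sig_ex, Del_Sig.
  del_with ltac:(first [apply Del_finseq; fn | apply Del_elt; fn | apply Del_sub_code; fn]).
Qed.

Lemma guided_exists n : exists s, guided s n.
Proof.
  revert n; apply (Sig_ind (P := fun n => exists s, guided s n)).
  - apply Sig_ex, Sig_guided; fn.
  - destruct (@binseq_exists _ _ 0 (fun _ => True)) as [s [Hs _]].
    { apply Del_ext with (fun v => v O = v O); [tauto|]; del_with fail. }
    exists s; split; [exact Hs|]; intros i Hi; destruct (not_lt0 Hi).
  - intros n [s [Hs Hg]].
    destruct (@binseq_exists _ _ (n + 1) (fun i => i < n /\ elt (npair i 1) s \/
      i = n /\ mem s X)) as [t [Ht1 Ht2]].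
    { del_with ltac:(apply Del_elt; fn). }
    assert (Hn : forall i, i < n -> i < n + 1)
      by (intros i Hi; exact (lt_trans Hi (lt_succ_diag n))).
    assert (Hirr : forall i, i < n -> i <> n)
      by (intros i Hi ->; exact (lt_irrefl Hi)).
    assert (Hst : forall i, i < n -> (elt (npair i 1) s <-> elt (npair i 1) t)).
    { intros i Hi; rewrite (proj1 (Ht2 i (Hn i Hi))).
      split; [tauto|]; intros [H|[E _]]; [tauto|destruct (Hirr i Hi E)]. }
    assert (Hsub : sub_code s t).
    { apply (sub_code_pairs (proj1 Hs)); intros i x Hx.
      pose proof (finseq_index (proj1 Hs) Hx) as Hi.
      exact (binseq_agree Hs Ht1 Hi (Hn i Hi) (Hst i Hi) Hx). }
    exists t; split; [exact Ht1|]; intros i Hi; apply lt_succ_cases in Hi.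
    destruct Hi as [Hi| ->].
    + destruct (Hg i Hi) as [u [Hu1 [Hu2 Hu3]]]; exists u; split; [exact Hu1|split].
      * intros w Hw; exact (Hsub w (Hu2 w Hw)).
      * now rewrite <- (Hst i Hi).
    + exists s; split; [exact (proj1 Hs)|split; [exact Hsub|]].
      rewrite (proj1 (Ht2 n (lt_succ_diag n))); split; [|tauto].
      intros [[H _]|H]; [destruct (lt_irrefl H)|tauto].
Qed.

(** Two histories that agree below [b] consult [X] at the same initial segment, hence agree at
    [b]. *)
Lemma guided_coherent s n t m : guided s n -> guided t m ->
  forall i, i < n -> i < m -> (elt (npair i 1) s <-> elt (npair i 1) t).
Proof.
  intros [Hs Hgs] [Ht Hgt].
  assert (H : forall b i, i < b -> i < n -> i < m ->
            (elt (npair i 1) s <-> elt (npair i 1) t)).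
  { apply (Sig_ind (P := fun b => forall i, i < b -> i < n -> i < m ->
            (elt (npair i 1) s <-> elt (npair i 1) t))).
    - apply Del_Sig; del_with ltac:(apply Del_elt; fn).
    - intros i Hi; destruct (not_lt0 Hi).
    - intros b IH i Hi Hin Him; apply lt_succ_cases in Hi; destruct Hi as [Hi| ->];
        [now apply IH|].
      destruct (Hgs b Hin) as [u [Hu1 [Hu2 Hu3]]].
      destruct (Hgt b Him) as [w [Hw1 [Hw2 Hw3]]].
      rewrite Hu3, Hw3; replace w with u; [reflexivity|].
      apply (finseq_sub_eq Hu1 Hw1), (sub_code_pairs Hu1); intros i x Hx.
      pose proof (finseq_index Hu1 Hx) as Hi.
      destruct (finseq_value Hw1 Hi) as [y Hy].
      replace x with y; [exact Hy|].
      apply (finseq_functional (proj1 Ht) (Hw2 _ Hy)).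
      assert (Hi1 : i < n) by exact (lt_trans Hi Hin).
      assert (Hi2 : i < m) by exact (lt_trans Hi Him).
      exact (binseq_agree Hs Ht Hi1 Hi2 (IH i Hi Hi1 Hi2) (Hu2 _ Hx)). }
  intros i; exact (H (i + 1) i (lt_succ_diag i)).
Qed.

(** Sequences shorter than [m] have codes below [B], so a node of [T] not below [B] reaches level
    [m] and can be cut there. *)
Lemma tree_level m : exists t, mem t T /\ finseq t m.
Proof.
  destruct (code_bound_exists (npair m 1 + 1)) as [B HB].
  destruct (HTinf B) as [s [HsT Hs]].
  destruct (proj1 HT s HsT) as [l [Hl Hb]].
  destruct (lt_or_le l m) as [Hlt|Hle].
  - exfalso; apply Hs, (code_lt_bound HB); [apply Hl|].
    intros w Hw; destruct (proj1 (proj2 Hl) w Hw) as [i [x [-> Hi]]].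
    apply lt_succ_le, npair_mono; [exact (lt_le_weak (lt_trans Hi Hlt))|].
    destruct (Hb i x Hw) as [-> | ->]; [apply zero_le|apply le_refl].
  - destruct (finseq_restrict Hl Hle) as [u [Hu1 [Hu2 _]]].
    exists u; split; [|exact Hu1]; exact (proj2 HT s u m HsT Hu1 Hu2).
Qed.

(* The level [m] of the extensions stays fixed, which keeps the induction
   Sigma^0_1. *)
Lemma guided_in_tree s m : guided s m -> mem s T.
Proof.
  intros [Hs Hg].
  assert (H : forall n, le n m -> exists t, mem t T /\ finseq t m /\
            forall i, i < n -> (elt (npair i 1) s <-> elt (npair i 1) t)).
  { intros n; rewrite <- lt_succ_le; revert n.
    apply (Sig_ind (P := fun n => n < m + 1 -> exists t, mem t T /\ finseq t m /\
            forall i, i < n -> (elt (npair i 1) s <-> elt (npair i 1) t))).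
    - apply Sig_imp; [del_with fail|]; apply Sig_ex, Del_Sig.
      del_with ltac:(first [apply Del_finseq; fn | apply Del_elt; fn]).
    - intros _; destruct (tree_level m) as [t [H1 H2]]; exists t.
      split; [exact H1|split; [exact H2|]]; intros i Hi; destruct (not_lt0 Hi).
    - intros n IH Hn; apply lt_succ_le, lt_le_succ in Hn.
      destruct IH as [t [HtT [Ht Hagree]]]; [exact (lt_trans Hn (lt_succ_diag m))|].
      destruct (Hg n Hn) as [u [Hu1 [Hu2 Hu3]]].
      assert (Hbin : forall t', mem t' T -> finseq t' m -> binseq t' m).
      { intros t' H1 H2; destruct (proj1 HT t' H1) as [l [Hl Hb]]; now split. }
      assert (Hsub : forall t', mem t' T -> finseq t' m ->
        (forall i, i < n -> (elt (npair i 1) s <-> elt (npair i 1) t')) <-> sub_code u t').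
      { intros t' H1 H2; split.
        - intros H; apply (sub_code_pairs Hu1); intros i x Hx.
          pose proof (finseq_index Hu1 Hx) as Hi; pose proof (lt_trans Hi Hn) as Him.
          exact (binseq_agree Hs (Hbin t' H1 H2) Him Him (H i Hi) (Hu2 _ Hx)).
        - intros H i Hi; destruct (finseq_value Hu1 Hi) as [x Hx].
          pose proof (Hu2 _ Hx) as Hxs; pose proof (H _ Hx) as Hxt; split; intros H1s.
          + now rewrite (finseq_functional (proj1 Hs) H1s Hxs).
          + now rewrite (finseq_functional H2 H1s Hxt). }
      assert (Hnext : forall b, elt (npair n b) s -> alive m u n b ->
        exists t, mem t T /\ finseq t m /\
          forall i, i < n + 1 -> (elt (npair i 1) s <-> elt (npair i 1) t)).
      { intros b Hb [t' [H1 [H2 [H3 H4]]]]; exists t'; split; [exact H1|split; [exact H2|]].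
        intros i Hi; apply lt_succ_cases in Hi; destruct Hi as [Hi| ->].
        - now apply (Hsub t' H1 H2).
        - split; intros H; [rewrite (finseq_functional (proj1 Hs) H Hb); exact H4|].
          rewrite (finseq_functional H2 H H4); exact Hb. }
      destruct (finseq_value Ht Hn) as [c Hc].
      assert (Hac : alive m u n c).
      { exists t; split; [exact HtT|split; [exact Ht|split; [|exact Hc]]].
        now apply (Hsub t HtT Ht). }
      (* The node [t] shows that some child of [u] is alive at level [m]. Were the child chosen by
         [s] dead there, it would die first, and [X] would have prescribed the other turn. *)
      destruct (classic (elt (npair n 1) s)) as [H1|H1].
      + apply (Hnext 1 H1); apply NNPP; intros Hd.
        apply (HX0 (s := u)); [|now apply Hu3]; exists m, n.
        destruct (proj2 (Hbin t HtT Ht) n c Hc) as [-> | ->]; [auto|tauto].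
      + apply (Hnext 0); [now apply (binseq_value Hs Hn)|]; apply NNPP; intros Hd.
        apply H1, Hu3, HX1; exists m, n.
        destruct (proj2 (Hbin t HtT Ht) n c Hc) as [-> | ->]; [tauto|auto]. }
  destruct (H m (le_refl m)) as [t [HtT [Ht Hagree]]].
  replace s with t; [exact HtT|]; symmetry.
  apply (finseq_sub_eq (proj1 Hs) Ht), (sub_code_pairs (proj1 Hs)); intros i x Hx.
  pose proof (finseq_index (proj1 Hs) Hx) as Hi.
  destruct (proj1 HT t HtT) as [l [Hl Hb]].
  exact (binseq_agree Hs (conj Ht Hb) Hi Hi (Hagree i Hi) Hx).
Qed.

Lemma guided_path : exists g, path T g.
Proof.
  destruct (@Del_comprehension _ _ (fun w => exists i x, w = npair i x /\
    exists s, guided s (i + 1) /\ elt (npair i x) s)) as [g Hg].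
  { split.
    - apply Sig_ex, Sig_ex, Sig_and; [apply Del_Sig; del_with fail|].
      apply Sig_ex, Sig_and; [apply Sig_guided; fn|apply Del_Sig, Del_elt; fn].
    (* Histories exist and cohere, so a pair is outside the path exactly when some history refutes
       it; this makes the path Delta^0_1. *)
    - apply Sig_ext with (fun v =>
        (forall i, i < v O + 1 -> forall x, x < v O + 1 -> v O <> npair i x) \/
        exists i x, v O = npair i x /\ exists s, guided s (i + 1) /\ ~ elt (npair i x) s).
      + intros v; split.
        * intros [H|[i [x [E [s [Hs Hx]]]]]] [i' [x' [E' [s' [Hs' Hx']]]]].
          -- apply (H i') with x'; [rewrite E'; apply lt_succ_le, le_npair_l
               |rewrite E'; apply lt_succ_le, le_npair_r|exact E'].
          -- rewrite E in E'; apply npair_inj in E'; destruct E' as [<- <-]; apply Hx.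
             apply (binseq_agree (proj1 Hs') (proj1 Hs) (lt_succ_diag i) (lt_succ_diag i));
               [|exact Hx'].
             apply (guided_coherent Hs' Hs); apply lt_succ_diag.
        * intros H; destruct (classic (exists i x, v O = npair i x)) as [[i [x E]]|Hn].
          -- right; exists i, x; split; [exact E|].
             destruct (guided_exists (i + 1)) as [s Hs]; exists s; split; [exact Hs|].
             intros Hx; apply H; exists i, x; eauto.
          -- left; intros i _ x _ E; apply Hn; eauto.
      + apply Sig_or; [apply Del_Sig; del_with fail|].
        apply Sig_ex, Sig_ex, Sig_and; [apply Del_Sig; del_with fail|].
        apply Sig_ex, Sig_and; [apply Sig_guided; fn|apply Del_Sig, Del_not, Del_elt; fn]. }
  assert (Hmaps : forall s n i x, guided s n -> i < n -> (elt (npair i x) s <-> maps g i x)).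
  { intros s n i x Hs Hi; unfold maps; rewrite Hg; split.
    - intros Hx; exists i, x; split; [reflexivity|].
      destruct (guided_exists (i + 1)) as [t Ht]; exists t; split; [exact Ht|].
      apply (binseq_agree (proj1 Hs) (proj1 Ht) Hi (lt_succ_diag i)); [|exact Hx].
      apply (guided_coherent Hs Ht Hi), lt_succ_diag.
    - intros [i' [x' [E [t [Ht Hx]]]]]; apply npair_inj in E; destruct E as [<- <-].
      apply (binseq_agree (proj1 Ht) (proj1 Hs) (lt_succ_diag i) Hi); [|exact Hx].
      apply (guided_coherent Ht Hs); [apply lt_succ_diag|exact Hi]. }
  exists g; split; [split|].
  - intros w Hw; apply Hg in Hw; destruct Hw as [i [x [-> [s [Hs Hx]]]]].
    exists i, x; split; [reflexivity|split; [exact I|]].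
    exact (proj2 (proj1 Hs) i x Hx).
  - intros i _; destruct (guided_exists (i + 1)) as [s Hs].
    pose proof (fun x => Hmaps s (i + 1) i x Hs (lt_succ_diag i)) as H.
    destruct (finseq_value (proj1 (proj1 Hs)) (lt_succ_diag i)) as [x Hx].
    exists x; split; [now apply H|]; intros y Hy; apply H in Hy.
    exact (finseq_functional (proj1 (proj1 Hs)) Hx Hy).
  - intros n; destruct (guided_exists n) as [s Hs]; exists s.
    split; [exact (guided_in_tree Hs)|split; [exact (proj1 (proj1 Hs))|]].
    intros i x Hi; exact (Hmaps s n i x Hs Hi).
Qed.

End Tree.

Lemma separation_WKL {M : L2_structure} {HM : RCA0 M} :
  Sigma1_separation (M := M) -> WKL M.
Proof.
  intros HS T HT Hinf.
  destruct (HS (dies_first T 0 1) (dies_first T 1 0)) as [X [HX1 HX0]].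
  - now apply Sig_dies_first.
  - now apply Sig_dies_first.
  - intros s; apply (dies_first_asym HT).
  - exact (guided_path HT HX1 HX0 Hinf).
Qed.

(** * Orders and interval representations *)

Section Order_basics.

Context {M : L2_structure} {HM : RCA0 M}.

Notation env := (nat -> num M).

Lemma Del_ole (P : rel_structure M) t u :
  Fn t -> Fn u -> Del (fun v : env => ole P (t v) (u v)).
Proof. intros Ht Hu; unfold ole; del_with fail. Qed.

Lemma Del_olt (P : rel_structure M) t u :
  Fn t -> Fn u -> Del (fun v : env => olt P (t v) (u v)).
Proof. intros Ht Hu; unfold olt; del_with ltac:(apply Del_ole; fn). Qed.

Lemma Del_indom (P : rel_structure M) t :
  Fn t -> Del (fun v : env => indom P (t v)).
Proof. intros Ht; unfold indom; del_with fail. Qed.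

Lemma Del_maps f t u : Fn t -> Fn u -> Del (fun v : env => maps f (t v) (u v)).
Proof. intros Ht Hu; unfold maps; del_with fail. Qed.

Lemma sub_prod_maps (F : sset M) (A B : num M -> Prop) p x :
  sub_prod F A B -> maps F p x -> A p /\ B x.
Proof.
  intros HF Hx; destruct (HF _ Hx) as [p' [x' [E H]]].
  apply npair_inj in E; now destruct E as [-> ->].
Qed.

Lemma ole_indom (P : rel_structure M) p q :
  partial_order P -> ole P p q -> indom P p /\ indom P q.
Proof. intros [HP _]; exact (sub_prod_maps HP). Qed.

Lemma olt_indom (P : rel_structure M) p q :
  partial_order P -> olt P p q -> indom P p /\ indom P q.
Proof. intros HP [H _]; exact (ole_indom HP H). Qed.

Lemma olt_ole_trans (P : rel_structure M) p q r :
  partial_order P -> olt P p q -> ole P q r -> olt P p r.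
Proof.
  intros [_ [_ [Ht Ha]]] [H1 H2] H3; split; [now apply Ht with q|].
  intros <-; apply H2, Ha; assumption.
Qed.

Lemma ole_olt_trans (P : rel_structure M) p q r :
  partial_order P -> ole P p q -> olt P q r -> olt P p r.
Proof.
  intros [_ [_ [Ht Ha]]] H1 [H2 H3]; split; [now apply Ht with q|].
  intros <-; apply H3, Ha; assumption.
Qed.

Lemma olt_trans (P : rel_structure M) p q r :
  partial_order P -> olt P p q -> olt P q r -> olt P p r.
Proof. intros HP H [H1 _]; exact (olt_ole_trans HP H H1). Qed.

Lemma olt_irrefl (P : rel_structure M) p : ~ olt P p p.
Proof. intros [_ H]; now apply H. Qed.

Lemma ole_cases (P : rel_structure M) p q : ole P p q -> p = q \/ olt P p q.
Proof. intros H; destruct (classic (p = q)); [now left|now right]. Qed.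

Lemma not_olt_ole (L : rel_structure M) x y :
  linear_order L -> indom L x -> indom L y -> ~ olt L x y -> ole L y x.
Proof.
  intros [HL Ht] Hx Hy H; destruct (Ht x y Hx Hy) as [H1|H1]; [|exact H1].
  destruct (ole_cases H1) as [->|H2]; [exact H1|tauto].
Qed.

Lemma olt_total (L : rel_structure M) x y :
  linear_order L -> indom L x -> indom L y -> x <> y -> olt L x y \/ olt L y x.
Proof.
  intros [HL Ht] Hx Hy H; destruct (Ht x y Hx Hy); [left|right]; split; auto.
Qed.

Lemma relation_exists (R : num M -> num M -> Prop) :
  Del (fun v => R (v O) (v 1%nat)) ->
  exists F : sset M, (forall p x, maps F p x <-> R p x) /\
    forall A B : num M -> Prop, (forall p x, R p x -> A p /\ B x) -> sub_prod F A B.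
Proof.
  intros HR.
  destruct (@Del_comprehension _ _ (fun w => exists x, x < w + 1 /\
    exists y, y < w + 1 /\ w = npair x y /\ R x y)) as [G HG].
  { del_with ltac:(apply (Del_rel2 HR); fn). }
  assert (H : forall p x, maps G p x <-> R p x).
  { intros x y; unfold maps; rewrite HG; split.
    - intros [x' [_ [y' [_ [E H]]]]]; apply npair_inj in E; now destruct E as [-> ->].
    - intros H; exists x; split; [apply lt_succ_le, le_npair_l|].
      exists y; split; [apply lt_succ_le, le_npair_r|auto]. }
  exists G; split; [exact H|]; intros A B HAB w Hw.
  destruct (proj1 (HG w) Hw) as [x [_ [y [_ [-> Hxy]]]]].
  exists x, y; split; [reflexivity|now apply HAB].
Qed.

Lemma rel_structure_exists (A : num M -> Prop) (R : num M -> num M -> Prop) :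
  Del (fun v => A (v O)) -> Del (fun v => R (v O) (v 1%nat)) ->
  exists L : rel_structure M, (forall x, indom L x <-> A x) /\
    (forall x y, ole L x y <-> R x y) /\
    ((forall x y, R x y -> A x /\ A y) -> sub_prod (leq_graph L) (indom L) (indom L)).
Proof.
  intros HA HR; destruct (Del_comprehension HA) as [D HD].
  destruct (relation_exists HR) as [G [HG HGs]].
  exists {| dom := D; leq_graph := G |}; split; [exact HD|split; [exact HG|]].
  intros H; apply HGs; intros x y Hxy; unfold indom; simpl; rewrite !HD; now apply H.
Qed.

End Order_basics.

(** * Representable orders omit 2+2 and 3+1; implications between the notions *)

Section Soundness.

Context {M : L2_structure} {HM : RCA0 M} (P : rel_structure M) (HP : partial_order P).

(** In a 3+1 the interval of [q] has a point at or below one of [p0] and a point at or above one of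
    [p2]. Convexity puts the interval of [p1] inside that of [q], and (i4) makes them equal,
    although [q] has a point strictly below all of [p1]. *)
Lemma proper_11_interval_order_sound :
  proper_11_interval_order P -> no_2plus2 P /\ no_3plus1 P.
Proof.
  intros [L [F [HL [HF [H1 [H2 [_ H4]]]]]]].
  assert (Hnot : forall p q, indom P p -> indom P q -> ~ ole P p q ->
            exists x y, maps F p x /\ maps F q y /\ ole L y x).
  { intros p q Hp Hq Hpq; apply NNPP; intros Hn; apply Hpq.
    apply (H2 p q Hp Hq); intros x y Hx Hy; apply NNPP; intros Hxy.
    apply Hn; exists x, y; split; [exact Hx|split; [exact Hy|]].
    apply (not_olt_ole HL); [apply (sub_prod_maps HF Hx)|apply (sub_prod_maps HF Hy)|exact Hxy]. }
  split.
  - intros p0 q0 p1 q1 H0 H0'; apply NNPP; intros Hc; apply not_or_and in Hc.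
    destruct Hc as [Hc0 Hc1].
    destruct (olt_indom HP H0) as [Hp0 Hq0]; destruct (olt_indom HP H0') as [Hp1 Hq1].
    destruct (Hnot _ _ Hp0 Hq1 Hc0) as [x0 [y1 [Hx0 [Hy1 Hle0]]]].
    destruct (Hnot _ _ Hp1 Hq0 Hc1) as [x1 [y0 [Hx1 [Hy0 Hle1]]]].
    apply (@olt_irrefl _ L x0).
    apply (olt_trans (proj1 HL) (proj1 (H2 _ _ Hp0 Hq0) H0 x0 y0 Hx0 Hy0)).
    apply (ole_olt_trans (proj1 HL) Hle1), (olt_ole_trans (proj1 HL) (q := y1));
      [|exact Hle0].
    exact (proj1 (H2 _ _ Hp1 Hq1) H0' x1 y1 Hx1 Hy1).
  - intros p0 p1 p2 q Hq H0 H0'; apply NNPP; intros Hc; apply not_or_and in Hc.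
    destruct Hc as [Hc0 Hc1].
    destruct (olt_indom HP H0) as [Hp0 Hp1]; destruct (olt_indom HP H0') as [_ Hp2].
    destruct (Hnot _ _ Hp0 Hq Hc0) as [x [y [Hx [Hy Hle0]]]].
    destruct (Hnot _ _ Hq Hp2 Hc1) as [y' [z [Hy' [Hz Hle1]]]].
    assert (Hyu : forall u, maps F p1 u -> olt L y u).
    { intros u Hu; apply (ole_olt_trans (proj1 HL) Hle0).
      exact (proj1 (H2 _ _ Hp0 Hp1) H0 x u Hx Hu). }
    assert (Hincl : forall u, maps F p1 u -> maps F q u).
    { intros u Hu; apply (proj2 (H1 q Hq) y u y'); [exact Hy|exact Hy'|now apply Hyu|].
      apply (olt_ole_trans (proj1 HL) (q := z)); [|exact Hle1].
      exact (proj1 (H2 _ _ Hp1 Hp2) H0' u z Hu Hz). }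
    apply (@olt_irrefl _ L y), Hyu, (H4 p1 q Hp1 Hq Hincl), Hy.
Qed.

(** For 3+1, (c5) replaces the inclusion argument: [q] starts before [p1], hence ends before [p1]
    does, yet it has to reach the left end of [p2]. *)
Lemma proper_closed_interval_order_sound :
  proper_closed_interval_order P -> no_2plus2 P /\ no_3plus1 P.
Proof.
  intros [L [f0 [f1 [[HL [[Hf0 Hf0'] [Hf1 Hf1']]] [H1 [H2 H5]]]]]].
  assert (Hval : forall p, indom P p -> exists x y, maps f0 p x /\ maps f1 p y).
  { intros p Hp; destruct (Hf0' p Hp) as [x [Hx _]]; destruct (Hf1' p Hp) as [y [Hy _]]; eauto. }
  assert (Hnot : forall p q x y, maps f1 p x -> maps f0 q y -> ~ ole P p q -> ole L y x).
  { intros p q x y Hx Hy Hn; apply (not_olt_ole HL).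
    - apply (sub_prod_maps Hf1 Hx).
    - apply (sub_prod_maps Hf0 Hy).
    - rewrite <- (H2 p q x y Hx Hy); unfold olt; tauto. }
  split.
  - intros p0 q0 p1 q1 H0 H0'; apply NNPP; intros Hc; apply not_or_and in Hc.
    destruct Hc as [Hc0 Hc1].
    destruct (olt_indom HP H0) as [Hp0 Hq0]; destruct (olt_indom HP H0') as [Hp1 Hq1].
    destruct (Hval _ Hp0) as [_ [x0 [_ Hx0]]]; destruct (Hval _ Hp1) as [_ [x1 [_ Hx1]]].
    destruct (Hval _ Hq0) as [y0 [_ [Hy0 _]]]; destruct (Hval _ Hq1) as [y1 [_ [Hy1 _]]].
    apply (@olt_irrefl _ L x0).
    apply (olt_trans (proj1 HL) (proj1 (H2 _ _ _ _ Hx0 Hy0) H0)).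
    apply (ole_olt_trans (proj1 HL) (Hnot _ _ _ _ Hx1 Hy0 Hc1)).
    apply (olt_ole_trans (proj1 HL) (q := y1)); [exact (proj1 (H2 _ _ _ _ Hx1 Hy1) H0')|].
    exact (Hnot _ _ _ _ Hx0 Hy1 Hc0).
  - intros p0 p1 p2 q Hq H0 H0'; apply NNPP; intros Hc; apply not_or_and in Hc.
    destruct Hc as [Hc0 Hc1].
    destruct (olt_indom HP H0) as [Hp0 Hp1]; destruct (olt_indom HP H0') as [_ Hp2].
    destruct (Hval _ Hp0) as [_ [x0 [_ Hx0]]]; destruct (Hval _ Hp1) as [y1 [x1 [Hy1 Hx1]]].
    destruct (Hval _ Hp2) as [y2 [_ [Hy2 _]]]; destruct (Hval _ Hq) as [a [b [Ha Hb]]].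
    assert (Hay : olt L a y1).
    { apply (ole_olt_trans (proj1 HL) (Hnot _ _ _ _ Hx0 Ha Hc0)).
      exact (proj1 (H2 _ _ _ _ Hx0 Hy1) H0). }
    apply (H5 q p1 a y1 b x1 Ha Hy1 Hb Hx1) in Hay.
    apply (@olt_irrefl _ L b), (olt_trans (proj1 HL) Hay).
    apply (olt_ole_trans (proj1 HL) (q := y2)); [exact (proj1 (H2 _ _ _ _ Hx1 Hy2) H0')|].
    exact (Hnot _ _ _ _ Hb Hy2 Hc1).
Qed.

Lemma proper_11_closed_closed :
  proper_11_closed_interval_order P -> proper_closed_interval_order P.
Proof. intros [L [f0 [f1 H]]]; exists L, f0, f1; tauto. Qed.

Lemma distinguishing_proper_11_closed :
  proper_distinguishing_interval_order P -> proper_11_closed_interval_order P.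
Proof.
  intros [L [f0 [f1 [He [H1 [H2 [H4 H5]]]]]]]; exists L, f0, f1.
  split; [exact He|split; [exact H1|split; [exact H2|split; [|exact H5]]]].
  intros p q x x' y y' Hpq Hx Hx' _ _; left.
  exact (H4 false false p q x x' (or_introl Hpq) Hx Hx').
Qed.

(** Take the closed intervals between the endpoints. By (c5), a strict difference at one end comes
    with one in the same direction at the other, so nested intervals have equal ends and (c3)
    identifies the points. This gives (i3) and (i4) together. *)
Lemma proper_11_closed_proper_11 :
  proper_11_closed_interval_order P -> proper_11_interval_order P.
Proof.
  intros [L [f0 [f1 [[HL [[Hf0 Hf0'] [Hf1 Hf1']]] [H1 [H2 [H3 H5]]]]]]].
  assert (Hval : forall p, indom P p -> exists x y, maps f0 p x /\ maps f1 p y).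
  { intros p Hp; destruct (Hf0' p Hp) as [x [Hx _]]; destruct (Hf1' p Hp) as [y [Hy _]]; eauto. }
  assert (Hfun0 : forall p x y, maps f0 p x -> maps f0 p y -> x = y).
  { intros p x y Hx Hy; destruct (Hf0' p (proj1 (sub_prod_maps Hf0 Hx))) as [z [_ Hz]].
    now rewrite <- (Hz x Hx), <- (Hz y Hy). }
  assert (Hfun1 : forall p x y, maps f1 p x -> maps f1 p y -> x = y).
  { intros p x y Hx Hy; destruct (Hf1' p (proj1 (sub_prod_maps Hf1 Hx))) as [z [_ Hz]].
    now rewrite <- (Hz x Hx), <- (Hz y Hy). }
  destruct (@relation_exists _ _ (fun p z => exists a b, maps f0 p a /\ maps f1 p b /\
    ole L a z /\ ole L z b)) as [F [HF HFsub]].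
  { split.
    - apply Sig_ex, Sig_ex, Del_Sig.
      del_with ltac:(first [apply Del_maps; fn | apply Del_ole; fn]).
    (* Endpoints exist and are unique on [P], so failure is witnessed by the endpoints that do not
       enclose the point. *)
    - apply Sig_ext with (fun v => ~ indom P (v O) \/ exists a b, maps f0 (v O) a /\
        maps f1 (v O) b /\ ~ (ole L a (v 1%nat) /\ ole L (v 1%nat) b)).
      + intros v; split.
        * intros [Hn|[a [b [Ha [Hb Hn]]]]] [a' [b' [Ha' [Hb' H]]]].
          -- apply Hn, (sub_prod_maps Hf0 Ha').
          -- now rewrite (Hfun0 _ _ _ Ha Ha'), (Hfun1 _ _ _ Hb Hb') in Hn.
        * intros Hn; destruct (classic (indom P (v O))) as [Hp|Hp]; [right|now left].
          destruct (Hval _ Hp) as [a [b [Ha Hb]]]; exists a, b.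
          split; [exact Ha|split; [exact Hb|]]; intros H; apply Hn; exists a, b; tauto.
      + apply Sig_or; [apply Del_Sig, Del_not, Del_indom; fn|].
        apply Sig_ex, Sig_ex, Del_Sig.
        del_with ltac:(first [apply Del_maps; fn | apply Del_ole; fn]). }
  assert (HFv : forall p a b z, maps f0 p a -> maps f1 p b ->
            (maps F p z <-> ole L a z /\ ole L z b)).
  { intros p a b z Ha Hb; rewrite HF; split; [|intros H; exists a, b; tauto].
    intros [a' [b' [Ha' [Hb' H]]]].
    now rewrite (Hfun0 _ _ _ Ha Ha'), (Hfun1 _ _ _ Hb Hb'). }
  assert (Hends : forall p a b, maps f0 p a -> maps f1 p b -> maps F p a /\ maps F p b).
  { intros p a b Ha Hb; pose proof (H1 p a b Ha Hb) as Hab.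
    destruct (ole_indom (proj1 HL) Hab) as [Ha' Hb'].
    rewrite !(HFv p a b _ Ha Hb); pose proof (proj1 (proj2 (proj1 HL))) as Hr; auto. }
  assert (Htrans : forall x y z, ole L x y -> ole L y z -> ole L x z) by apply (proj1 HL).
  assert (Hincl : forall p q, indom P p -> indom P q ->
            (forall x, maps F p x -> maps F q x) -> p = q).
  { intros p q Hp Hq Hpq; destruct (Hval p Hp) as [a [b [Ha Hb]]].
    destruct (Hval q Hq) as [a' [b' [Ha' Hb']]]; destruct (Hends p a b Ha Hb) as [Hea Heb].
    apply Hpq, (HFv q a' b' _ Ha' Hb') in Hea; apply Hpq, (HFv q a' b' _ Ha' Hb') in Heb.
    apply NNPP; intros Hne; destruct (H3 p q a a' b b' Hne Ha Ha' Hb Hb') as [E|E].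
    - assert (Hlt : olt L a' a) by (split; [tauto|congruence]).
      apply (H5 q p a' a b' b Ha' Ha Hb' Hb) in Hlt.
      exact (olt_irrefl (olt_ole_trans (proj1 HL) Hlt (proj2 Heb))).
    - assert (Hlt : olt L b b') by (split; [tauto|congruence]).
      apply (H5 p q a a' b b' Ha Ha' Hb Hb') in Hlt.
      exact (olt_irrefl (olt_ole_trans (proj1 HL) Hlt (proj1 Hea))). }
  exists L, F; split; [exact HL|split; [|split; [|split; [|split]]]].
  - apply HFsub; intros p z [a [b [Ha [_ [Haz _]]]]].
    split; [apply (sub_prod_maps Hf0 Ha)|apply (ole_indom (proj1 HL) Haz)].
  - intros p Hp; destruct (Hval p Hp) as [a [b [Ha Hb]]]; split.
    + exists a; apply (Hends p a b Ha Hb).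
    + intros x y z Hx Hz Hxy Hyz; rewrite !(HFv p a b _ Ha Hb) in *; split.
      * apply Htrans with x; [tauto|apply Hxy].
      * apply Htrans with z; [apply Hyz|tauto].
  - intros p q Hp Hq; destruct (Hval p Hp) as [a [b [Ha Hb]]].
    destruct (Hval q Hq) as [a' [b' [Ha' Hb']]]; rewrite (H2 p q b a' Hb Ha'); split.
    + intros H x y Hx Hy; apply (HFv p a b _ Ha Hb) in Hx; apply (HFv q a' b' _ Ha' Hb') in Hy.
      apply (ole_olt_trans (proj1 HL) (proj2 Hx)), (olt_ole_trans (proj1 HL) H), Hy.
    + intros H; apply H; [apply (Hends p a b Ha Hb)|apply (Hends q a' b' Ha' Hb')].
  - intros p q Hp Hq Hne H; apply Hne, Hincl; auto; apply H.
  - intros p q Hp Hq H; now rewrite (Hincl p q Hp Hq H).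
Qed.

End Soundness.

(** * From separation to representations *)

Section Linearization.

Context {M : L2_structure} {HM : RCA0 M} (HS : Sigma1_separation (M := M)).
Context (P : rel_structure M) (HP : partial_order P)
  (H22 : no_2plus2 P) (H31 : no_3plus1 P).

Notation env := (nat -> num M).

Definition trace_lt (p q : num M) : Prop :=
  indom P p /\ indom P q /\
  exists r, olt P r q /\ ~ olt P r p \/ olt P p r /\ ~ olt P q r.

Lemma Sig_trace_lt t u : Fn t -> Fn u -> Sig (fun v : env => trace_lt (t v) (u v)).
Proof.
  intros Ht Hu; apply Sig_and; [apply Del_Sig, Del_indom; fn|].
  apply Sig_and; [apply Del_Sig, Del_indom; fn|].
  apply Sig_ex, Del_Sig; del_with ltac:(apply Del_olt; fn).
Qed.

(** Two witnesses on the same side, both below or both above, give a 2+2; witnesses on opposite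
    sides give a 3+1. *)
Lemma trace_lt_asym p q : trace_lt p q -> trace_lt q p -> False.
Proof.
  intros [Hp [Hq [r Hr]]] [_ [_ [s Hs]]].
  assert (Hbb : forall x y, olt P r x -> ~ olt P r y -> olt P s y -> ~ olt P s x -> False).
  { intros x y H1 H2 H3 H4; destruct (H22 H1 H3) as [H|H]; apply ole_cases in H;
      destruct H as [->|H]; eauto using olt_trans. }
  assert (Haa : forall x y, olt P x r -> ~ olt P y r -> olt P y s -> ~ olt P x s -> False).
  { intros x y H1 H2 H3 H4; destruct (H22 H1 H3) as [H|H]; apply ole_cases in H;
      destruct H as [E|H]; try tauto; subst; eauto using olt_trans. }
  assert (Hba : forall x y z w, indom P y -> olt P z x -> ~ olt P z y -> olt P x w ->
            ~ olt P y w -> False).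
  { intros x y z w Hy H1 H2 H3 H4; destruct (H31 Hy H1 H3) as [H|H]; apply ole_cases in H;
      destruct H as [->|H]; eauto using olt_trans. }
  destruct Hr as [[H1 H1']|[H1 H1']], Hs as [[H2a H2b]|[H2a H2b]]; eauto.
Qed.

Lemma trace_lt_cotrans p q r :
  indom P r -> trace_lt p q -> trace_lt p r \/ trace_lt r q.
Proof.
  intros Hr [Hp [Hq [z Hz]]]; unfold trace_lt.
  destruct Hz as [Hz|Hz].
  - destruct (classic (olt P z r)); [left|right]; split; try split; auto; exists z; tauto.
  - destruct (classic (olt P r z)); [right|left]; split; try split; auto; exists z; tauto.
Qed.

Lemma not_trace_lt p q : indom P p -> indom P q -> ~ trace_lt q p ->
  (forall r, olt P r p -> olt P r q) /\ (forall r, olt P q r -> olt P p r).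
Proof.
  intros Hp Hq H; split; intros r Hr; apply NNPP; intros Hn; apply H;
    (split; [exact Hq|split; [exact Hp|]]); exists r; tauto.
Qed.

Lemma trace_tournament : exists W : num M -> num M -> Prop,
  Del (fun v => W (v O) (v 1%nat)) /\ (forall p, W p p) /\
  (forall p q, p <> q -> (W p q <-> ~ W q p)) /\
  (forall p q, W p q -> ~ trace_lt q p).
Proof.
  destruct (HS (A := fun w => exists p q, w = npair p q /\ trace_lt p q)
    (B := fun w => exists p q, w = npair p q /\ trace_lt q p)) as [X [HX1 HX2]].
  - apply Sig_ex, Sig_ex, Sig_and; [apply Del_Sig; del_with fail|apply Sig_trace_lt; fn].
  - apply Sig_ex, Sig_ex, Sig_and; [apply Del_Sig; del_with fail|apply Sig_trace_lt; fn].
  - intros w [p [q [-> H]]] [p' [q' [E H']]]; apply npair_inj in E; destruct E as [<- <-].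
    exact (trace_lt_asym H H').
  (* The separating set may hold both or neither of the two codes of an unordered pair, so only the
     code with the smaller number first is consulted. *)
  - exists (fun p q => p = q \/ p < q /\ mem (npair p q) X \/ q < p /\ ~ mem (npair q p) X).
    split; [del_with fail|split; [auto|split]].
    + intros p q Hne; assert (Hne' : q <> p) by congruence.
      assert (Has : p < q -> q < p -> False)
        by (intros H H'; exact (lt_irrefl (lt_trans H H'))).
      destruct (lt_trichotomy p q) as [H|[H|H]]; tauto.
    + intros p q [->|[[_ H]|[_ H]]] Hlt.
      * exact (trace_lt_asym Hlt Hlt).
      * apply (HX2 (npair p q)); [now exists p, q|exact H].
      * apply H, HX1; now exists q, p.
Qed.

(* The tournament [W] need not be transitive; comparing the characteristic
   functions of its columns lexicographically turns it into a linear order that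
   still respects the trace. *)
Lemma semiorder_linearization : exists R : num M -> num M -> Prop,
  Del (fun v => R (v O) (v 1%nat)) /\
  (forall p q, R p q -> indom P p /\ indom P q) /\
  (forall p, ~ R p p) /\
  (forall p q r, R p q -> R q r -> R p r) /\
  (forall p q, indom P p -> indom P q -> p = q \/ R p q \/ R q p) /\
  (forall p q, R p q ->
     (forall r, olt P r p -> olt P r q) /\ (forall r, olt P q r -> olt P p r)).
Proof.
  destruct trace_tournament as [W [HW [Hrefl [Hanti Htr]]]].
  pose (R p q := exists r, indom P p /\ indom P q /\ indom P r /\ W r q /\ ~ W r p /\
    forall s, s < r -> indom P s -> (W s p <-> W s q)).
  assert (Hirr : forall p, ~ R p p) by (intros p [r H]; tauto).
  exists R; split; [|split; [|split; [exact Hirr|split; [|split]]]].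
  (* The first difference [r] is at most [p + q]: columns agreeing at rows [p] and [q] would, by
     reflexivity, give both [W p q] and [W q p]. *)
  - apply Del_ex with (t := fun v => v O + v 1%nat + 1); [fn| |].
    + intros v r [Hp [Hq [Hr [H1 [H2 H3]]]]].
      apply lt_succ_le, not_lt_le; intros Hlt.
      assert (Hne : v O <> v 1%nat) by (intros E; rewrite E in H2; tauto).
      assert (Hlp : v O < r) by (apply le_lt_trans with (2 := Hlt), le_addr).
      assert (Hlq : v 1%nat < r) by (apply le_lt_trans with (2 := Hlt), le_addl).
      pose proof (H3 _ Hlp Hp) as Ep; pose proof (H3 _ Hlq Hq) as Eq.
      pose proof (Hanti _ _ Hne); pose proof (Hrefl (v O)); pose proof (Hrefl (v 1%nat)).
      tauto.
    + del_with ltac:(first [apply Del_indom; fn | apply (Del_rel2 HW); fn]).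
  - intros p q [r H]; tauto.
  - intros p q s [r1 [Hp [Hq [Hr1 [H1 [H1' E1]]]]]] [r2 [_ [Hs [Hr2 [H2 [H2' E2]]]]]].
    destruct (lt_trichotomy r1 r2) as [H|[->|H]]; [|tauto|].
    + exists r1; repeat (split; [assumption|]); split; [now apply E2|split; [exact H1'|]].
      intros z Hz Hz'; rewrite (E1 z Hz Hz'); exact (E2 z (lt_trans Hz H) Hz').
    + exists r2; repeat (split; [assumption|]); split; [now rewrite E1|].
      intros z Hz Hz'; rewrite (E1 z (lt_trans Hz H) Hz'); exact (E2 z Hz Hz').
  - intros p q Hp Hq; destruct (classic (p = q)) as [E|Hne]; [now left|right].
    destruct (@least_element _ _ (fun r => indom P r /\ ~ (W r p <-> W r q)))
      as [r [[Hr Hd] Hmin]].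
    + del_with ltac:(first [apply Del_indom; fn | apply (Del_rel2 HW); fn]).
    + pose proof (Hanti _ _ Hne); pose proof (Hrefl p); pose proof (Hrefl q).
      destruct (classic (W p q)); [exists q|exists p]; tauto.
    + assert (Hag : forall s, s < r -> indom P s -> (W s p <-> W s q)).
      { intros s Hs Hs'; apply NNPP; intros Hn; exact (Hmin s Hs (conj Hs' Hn)). }
      destruct (classic (W r q)); [left|right]; exists r;
        repeat (split; [assumption|]); [tauto|].
      split; [tauto|split; [tauto|]]; intros s Hs Hs'; symmetry; now apply Hag.
  (* Row [r] lies between the two points: [W r q] excludes [trace_lt q r], and the failure of
     [W r p] gives [W p r], which excludes [trace_lt r p]. Cotransitivity then excludes
     [trace_lt q p]. *)
  - intros p q [r [Hp [Hq [Hr [H1 [H2 _]]]]]]; apply not_trace_lt; [exact Hp|exact Hq|].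
    intros Hlt; destruct (trace_lt_cotrans Hr Hlt) as [H|H].
    + exact (Htr _ _ H1 H).
    + assert (Hne : r <> p) by (intros ->; apply H2, Hrefl).
      apply (Htr p r); [|exact H]; apply NNPP; intros Hn; apply H2, (Hanti _ _ Hne), Hn.
Qed.

Lemma semiorder_distinguishing : proper_distinguishing_interval_order P.
Proof.
  destruct semiorder_linearization as [R [HR [Hdom [Hirr [Htrans [Htot Hcomp]]]]]].
  pose (R' p q := indom P p /\ p = q \/ R p q).
  assert (Hdom' : forall p q, R' p q -> indom P p /\ indom P q).
  { intros p q [[Hp <-]|H]; [tauto|now apply Hdom]. }
  assert (Htot' : forall p q, indom P p -> indom P q -> ~ R q p -> R' p q).
  { intros p q Hp Hq H; unfold R'; destruct (Htot p q Hp Hq); tauto. }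
  assert (Hl : forall p q r, R' p q -> olt P r p -> olt P r q).
  { intros p q r [[_ <-]|H]; [tauto|apply (Hcomp p q H)]. }
  assert (Hr : forall p q r, R' p q -> olt P q r -> olt P p r).
  { intros p q r [[_ <-]|H]; [tauto|apply (Hcomp p q H)]. }
  (* Tag 0 marks left endpoints and tag 1 right ones. The last clause is the complement of the one
     before it on [P], which makes mixed endpoints comparable in exactly one way. *)
  pose (E (p i q j : num M) := (i = 0 /\ j = 0 \/ i = 1 /\ j = 1) /\ R' p q \/
    i = 1 /\ j = 0 /\ olt P p q \/
    i = 0 /\ j = 1 /\ indom P p /\ indom P q /\ ~ olt P q p).
  destruct (@rel_structure_exists _ _
    (fun u => exists p, p < u + 1 /\ indom P p /\ (u = npair p 0 \/ u = npair p 1))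
    (fun u w => exists p, p < u + 1 /\ exists i, i < u + 1 /\
       exists q, q < w + 1 /\ exists j, j < w + 1 /\
       u = npair p i /\ w = npair q j /\ E p i q j)) as [L [HLd [HLo HLs]]].
  { del_with ltac:(apply Del_indom; fn). }
  { unfold E, R'; del_with ltac:(first [apply Del_indom; fn | apply (Del_rel2 HR); fn
      | apply Del_olt; fn]). }
  pose proof (@zero_neq_one M HM) as H01.
  pose proof (not_eq_sym H01) as H10.
  assert (Ho : forall p i q j, ole L (npair p i) (npair q j) <-> E p i q j).
  { intros p i q j; rewrite HLo; split.
    - intros [p' [_ [i' [_ [q' [_ [j' [_ [E1 [E2 H]]]]]]]]]].
      apply npair_inj in E1; apply npair_inj in E2.
      now destruct E1 as [-> ->], E2 as [-> ->].
    - intros H; exists p; split; [apply lt_succ_le, le_npair_l|].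
      exists i; split; [apply lt_succ_le, le_npair_r|].
      exists q; split; [apply lt_succ_le, le_npair_l|].
      exists j; split; [apply lt_succ_le, le_npair_r|auto]. }
  assert (Ho00 : forall p q, ole L (npair p 0) (npair q 0) <-> R' p q)
    by (intros p q; rewrite Ho; unfold E; tauto).
  assert (Ho11 : forall p q, ole L (npair p 1) (npair q 1) <-> R' p q)
    by (intros p q; rewrite Ho; unfold E; tauto).
  assert (Ho10 : forall p q, ole L (npair p 1) (npair q 0) <-> olt P p q)
    by (intros p q; rewrite Ho; unfold E; tauto).
  assert (Ho01 : forall p q, ole L (npair p 0) (npair q 1) <->
            indom P p /\ indom P q /\ ~ olt P q p)
    by (intros p q; rewrite Ho; unfold E; tauto).
  assert (Hd : forall u, indom L u <->
            exists p, indom P p /\ (u = npair p 0 \/ u = npair p 1)).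
  { intros u; rewrite HLd; split; [intros [p [_ H]]; eauto|].
    intros [p [Hp H]]; exists p; split; [|auto].
    destruct H as [-> | ->]; apply lt_succ_le, le_npair_l. }
  assert (Hsub : forall u w, ole L u w -> indom L u /\ indom L w).
  { intros u w Huw; rewrite !Hd; apply HLo in Huw.
    destruct Huw as [p [_ [i [_ [q [_ [j [_ [-> [-> H]]]]]]]]]].
    assert (Hpq : indom P p /\ indom P q).
    { destruct H as [[_ H]|[[_ [_ H]]|H]]; [now apply Hdom'|exact (olt_indom HP H)|tauto]. }
    split; [exists p|exists q]; (split; [tauto|]);
      destruct H as [[[[-> ->]|[-> ->]] _]|[[-> [-> _]]|[-> [-> _]]]]; auto. }
  assert (HL : linear_order L).
  { split; [split; [|split; [|split]]|].
    - apply HLs; intros x y Hxy; rewrite <- !HLd; apply Hsub, HLo, Hxy.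
    - intros u Hu; apply Hd in Hu; destruct Hu as [p [Hp [-> | ->]]].
      + apply Ho00; left; auto.
      + apply Ho11; left; auto.
    - intros x y z Hxy Hyz.
      destruct (Hsub _ _ Hxy) as [Hx Hy]; destruct (Hsub _ _ Hyz) as [_ Hz].
      apply Hd in Hx; apply Hd in Hy; apply Hd in Hz.
      destruct Hx as [p [Hp Hx]], Hy as [q [Hq Hy]], Hz as [r [Hr' Hz]].
      assert (Htr : R' p q -> R' q r -> R' p r).
      { intros [[_ <-]|H] [[_ <-]|H']; unfold R'; eauto. }
      (* The two unmixed patterns are transitivity of [R']; the six mixed ones say that strict lower
         cones grow and strict upper cones shrink along [R]. *)
      destruct Hx as [-> | ->], Hy as [-> | ->], Hz as [-> | ->];
        rewrite ?Ho00, ?Ho01, ?Ho10, ?Ho11 in *.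
      + auto.
      + split; [exact Hp|split; [exact Hr'|]]; intros H; apply Hyz, (Hl p q r Hxy H).
      + apply (Htot' p r Hp Hr'); intros H; apply Hxy, (proj1 (Hcomp _ _ H)), Hyz.
      + split; [exact Hp|split; [exact Hr'|]]; intros H; apply Hxy, (Hr q r p Hyz H).
      + exact (Hl q r p Hyz Hxy).
      + apply (Htot' p r Hp Hr'); intros H; apply Hyz, (proj2 (Hcomp _ _ H)), Hxy.
      + exact (Hr p q r Hxy Hyz).
      + auto.
    - intros x y Hxy Hyx; destruct (Hsub _ _ Hxy) as [Hx Hy].
      apply Hd in Hx; apply Hd in Hy.
      destruct Hx as [p [Hp Hx]], Hy as [q [Hq Hy]].
      assert (Has : R' p q -> R' q p -> p = q).
      { intros [[_ H]|H] [[_ H']|H']; auto; destruct (Hirr p); eauto. }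
      destruct Hx as [-> | ->], Hy as [-> | ->];
        rewrite ?Ho00, ?Ho01, ?Ho10, ?Ho11 in *; try tauto; f_equal; auto.
    - intros x y Hx Hy; apply Hd in Hx; apply Hd in Hy.
      destruct Hx as [p [Hp Hx]], Hy as [q [Hq Hy]].
      assert (Htt : R' p q \/ R' q p) by (unfold R'; destruct (Htot p q Hp Hq); tauto).
      destruct Hx as [-> | ->], Hy as [-> | ->]; rewrite ?Ho00, ?Ho01, ?Ho10, ?Ho11; tauto. }
  assert (Hfun : forall i, i = 0 \/ i = 1 -> exists f : sset M,
            is_function f (indom P) (indom L) /\
            forall p x, maps f p x <-> indom P p /\ x = npair p i).
  { intros i Hi; destruct (@relation_exists _ _ (fun p x => indom P p /\ x = npair p i))
      as [f [Hf Hfs]].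
    { del_with ltac:(apply Del_indom; fn). }
    exists f; split; [split|exact Hf].
    - apply Hfs; intros p x [Hp ->]; split; [exact Hp|]; apply Hd; exists p.
      destruct Hi as [-> | ->]; auto.
    - intros p Hp; exists (npair p i); split; [now apply Hf|].
      intros x Hx; apply Hf in Hx; symmetry; tauto. }
  destruct (Hfun 0) as [f0 [Hf0 Hf0v]]; [auto|].
  destruct (Hfun 1) as [f1 [Hf1 Hf1v]]; [auto|].
  assert (Hne : forall p q i : num M, npair p i <> npair q i <-> p <> q).
  { intros p q i; split; intros H E1; apply H; [now rewrite E1|].
    now apply npair_inj in E1. }
  exists L, f0, f1; split; [split; [exact HL|split; assumption]|].
  split; [|split; [|split]].
  - intros p x y Hx Hy; apply Hf0v in Hx; apply Hf1v in Hy.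
    destruct Hx as [Hp ->], Hy as [_ ->]; apply Ho01.
    split; [exact Hp|split; [exact Hp|apply olt_irrefl]].
  - intros p q x y Hx Hy; apply Hf1v in Hx; apply Hf0v in Hy.
    destruct Hx as [Hp ->], Hy as [Hq ->].
    unfold olt at 2; rewrite Ho10; split; [|tauto]; intros H; split; [exact H|].
    intros E1; apply npair_inj in E1; tauto.
  - intros i j p q x y H Hx Hy Exy; subst y.
    destruct i, j; rewrite ?Hf0v, ?Hf1v in *; destruct Hx as [_ ->], Hy as [_ E1];
      apply npair_inj in E1; destruct E1 as [-> E1]; destruct H; congruence.
  - intros p q x x' y y' Hx Hx' Hy Hy'; rewrite ?Hf0v, ?Hf1v in *.
    destruct Hx as [_ ->], Hx' as [_ ->], Hy as [_ ->], Hy' as [_ ->].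
    unfold olt; rewrite Ho00, Ho11, !Hne; reflexivity.
Qed.

End Linearization.

(** * From representations to separation *)

Section Reversal.

Context {M : L2_structure} {HM : RCA0 M}.

Notation env := (nat -> num M).

(* Block [n] has the two incomparable points [a_n = (n, 0)] and [b_n = (n, 1)];
   a witness [k] for [A n] (resp. [B n]) puts [(n, k + 2)] below [b_n] only
   (resp. below [a_n] only).  Blocks are stacked in order of [n]. *)
Lemma coding_order (A B : num M -> Prop) :
  Sig (fun v => A (v O)) -> Sig (fun v => B (v O)) ->
  (forall n, A n -> B n -> False) ->
  exists P : rel_structure M, partial_order P /\ no_2plus2 P /\ no_3plus1 P /\
    (forall n i, indom P (npair n i)) /\
    (forall n, A n -> exists c, olt P c (npair n 1) /\ ~ olt P c (npair n 0)) /\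
    (forall n, B n -> exists c, olt P c (npair n 0) /\ ~ olt P c (npair n 1)).
Proof.
  intros HA HB Hdisj.
  destruct (Sig_kernel HA) as [alpha [Ha HA']]; destruct (Sig_kernel HB) as [beta [Hb HB']].
  (* The shift by two keeps witness points apart from the indices 0 and 1 of the two incomparable
     points; [k < i] bounds the quantifier. *)
  pose (R (n i j : num M) := exists k, k < i /\ i = k + 1 + 1 /\
    (j = 1 /\ alpha k n \/ j = 0 /\ beta k n)).
  pose (S (n i m j : num M) := n < m \/ n = m /\ R n i j).
  pose proof (@zero_neq_one M HM) as H01.
  (* Lower points have index at least 2 and upper points index 0 or 1, so a block contains no chain
     of three. *)
  assert (Hheight : forall n i j l, R n i j -> R n j l -> False).
  { intros n i j l [k [_ [_ H]]] [k' [_ [E _]]]; destruct H as [[-> _]|[-> _]].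
    - apply (succ_neq0 (proj1 HM) (n := k')); symmetry.
      apply (succ_inj (proj1 HM)); now rewrite add0n.
    - exact (succ_neq0 (proj1 HM) (eq_sym E)). }
  (* By disjointness, only one of the two incomparable points of a block has anything of that block
     below it. *)
  assert (Htop : forall n i j i' j', R n i j -> R n i' j' -> j = j').
  { intros n i j i' j' [k [_ [_ H]]] [k' [_ [_ H']]].
    destruct H as [[-> H]|[-> H]], H' as [[-> H']|[-> H']]; try reflexivity;
      destruct (Hdisj n); try (apply HA'; eauto); apply HB'; eauto. }
  assert (HRirr : forall n i, ~ R n i i) by (intros n i H; exact (Hheight n i i i H H)).
  destruct (@rel_structure_exists _ _
    (fun p => exists n, n < p + 1 /\ exists i, i < p + 1 /\ p = npair n i)
    (fun p q => exists n, n < p + 1 /\ exists i, i < p + 1 /\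
       exists m, m < q + 1 /\ exists j, j < q + 1 /\
       p = npair n i /\ q = npair m j /\ (p = q \/ S n i m j))) as [P [HPd [HPo HPs]]].
  { del_with fail. }
  { unfold S, R; del_with ltac:(first [apply (Del_rel2 Ha); fn | apply (Del_rel2 Hb); fn]). }
  assert (Hd : forall p, indom P p <-> exists n i, p = npair n i).
  { intros p; rewrite HPd; split; [intros [n [_ [i [_ H]]]]; eauto|].
    intros [n [i ->]]; exists n; split; [apply lt_succ_le, le_npair_l|].
    exists i; split; [apply lt_succ_le, le_npair_r|reflexivity]. }
  assert (Ho : forall n i m j, ole P (npair n i) (npair m j) <->
            (n = m /\ i = j) \/ S n i m j).
  { intros n i m j; rewrite HPo; split.
    - intros [n' [_ [i' [_ [m' [_ [j' [_ [E1 [E2 H]]]]]]]]]].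
      destruct H as [H|H]; [left; exact (npair_inj H)|right].
      apply npair_inj in E1; apply npair_inj in E2.
      now destruct E1 as [-> ->], E2 as [-> ->].
    - intros H; exists n; split; [apply lt_succ_le, le_npair_l|].
      exists i; split; [apply lt_succ_le, le_npair_r|].
      exists m; split; [apply lt_succ_le, le_npair_l|].
      exists j; split; [apply lt_succ_le, le_npair_r|].
      split; [reflexivity|split; [reflexivity|]].
      destruct H as [[-> ->]|H]; auto. }
  assert (HSirr : forall n i, ~ S n i n i).
  { intros n i [H|[_ H]]; [exact (lt_irrefl H)|exact (HRirr n i H)]. }
  assert (Hlt : forall n i m j, olt P (npair n i) (npair m j) <-> S n i m j).
  { intros n i m j; unfold olt; rewrite Ho; split.
    - intros [[[-> ->]|H] Hne]; [now destruct Hne|exact H].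
    - intros H; split; [now right|]; intros E; apply npair_inj in E.
      destruct E as [-> ->]; exact (HSirr m j H). }
  (* Blocks have no chain of three, so two consecutive strict steps lead to a later block. *)
  assert (HStr : forall n i m j l k, S n i m j -> S m j l k -> n < l).
  { intros n i m j l k [H|[<- H]] [H'|[<- H']]; auto.
    - exact (lt_trans H H').
    - destruct (Hheight n i j k H H'). }
  assert (Hsub : sub_prod (leq_graph P) (indom P) (indom P)).
  { apply HPs; intros p q [n [Hn [i [Hi [m [Hm [j [Hj [-> [-> _]]]]]]]]]].
    split; [exists n|exists m]; (split; [assumption|]); [exists i|exists j]; auto. }
  assert (HP : partial_order P).
  { split; [exact Hsub|split; [|split]].
    - intros p Hp; apply Hd in Hp; destruct Hp as [n [i ->]]; apply Ho; auto.
    - intros p q r Hpq Hqr; destruct (sub_prod_maps Hsub Hpq) as [Hp Hq].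
      destruct (sub_prod_maps Hsub Hqr) as [_ Hr].
      apply Hd in Hp; apply Hd in Hq; apply Hd in Hr.
      destruct Hp as [n [i ->]], Hq as [m [j ->]], Hr as [l [k ->]].
      apply Ho in Hpq; apply Ho in Hqr; apply Ho.
      destruct Hpq as [[-> ->]|Hpq]; [exact Hqr|].
      destruct Hqr as [[<- <-]|Hqr]; right; [exact Hpq|].
      left; exact (HStr _ _ _ _ _ _ Hpq Hqr).
    - intros p q Hpq Hqp; destruct (sub_prod_maps Hsub Hpq) as [Hp Hq].
      apply Hd in Hp; apply Hd in Hq; destruct Hp as [n [i ->]], Hq as [m [j ->]].
      apply Ho in Hpq; apply Ho in Hqp.
      destruct Hpq as [[-> ->]|Hpq]; [reflexivity|].
      destruct Hqp as [[-> ->]|Hqp]; [reflexivity|].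
      destruct (lt_irrefl (HStr _ _ _ _ _ _ Hpq Hqp)). }
  assert (Hcoord : forall p q, olt P p q -> exists n i m j,
            p = npair n i /\ q = npair m j /\ S n i m j).
  { intros p q H; destruct (olt_indom HP H) as [Hp Hq].
    apply Hd in Hp; apply Hd in Hq; destruct Hp as [n [i ->]], Hq as [m [j ->]].
    exists n, i, m, j; rewrite <- Hlt; auto. }
  exists P; split; [exact HP|split; [|split; [|split; [|split]]]].
  - intros p0 q0 p1 q1 H0 H1; apply Hcoord in H0; apply Hcoord in H1.
    destruct H0 as [n0 [i0 [m0 [j0 [-> [-> H0]]]]]], H1 as [n1 [i1 [m1 [j1 [-> [-> H1]]]]]].
    rewrite !Ho.
    assert (Hle0 : le n0 m0)
      by (destruct H0 as [H0|[-> _]]; [now apply lt_le_weak|apply le_refl]).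
    assert (Hle1 : le n1 m1)
      by (destruct H1 as [H1|[-> _]]; [now apply lt_le_weak|apply le_refl]).
    (* If neither lower point sits in an earlier block than the opposite upper point, all four
       points share one block, where [Htop] makes the upper points equal. *)
    destruct (lt_or_le n0 m1) as [Hlt0|Hge0]; [left; right; now left|].
    destruct (lt_or_le n1 m0) as [Hlt1|Hge1]; [right; right; now left|].
    assert (E0 : m0 = n0) by (apply le_antisym; [|exact Hle0];
      exact (le_trans Hge1 (le_trans Hle1 Hge0))).
    assert (E1 : n1 = n0) by (apply le_antisym; [exact (le_trans Hle1 Hge0)|];
      exact (le_trans Hle0 Hge1)).
    assert (E2 : m1 = n0) by (apply le_antisym; [exact Hge0|];
      exact (le_trans Hle0 (le_trans Hge1 Hle1))).
    subst; left; right; right; split; [reflexivity|].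
    destruct H0 as [H0|[_ H0]]; [destruct (lt_irrefl H0)|].
    destruct H1 as [H1|[_ H1]]; [destruct (lt_irrefl H1)|].
    now rewrite <- (Htop _ _ _ _ _ H0 H1).
  - intros p0 p1 p2 q Hq H0 H1; apply Hcoord in H0; apply Hcoord in H1.
    destruct H0 as [n [i [m [j [-> [-> H0]]]]]], H1 as [m' [j' [l [k [E [-> H1]]]]]].
    apply npair_inj in E; destruct E as [<- <-].
    apply Hd in Hq; destruct Hq as [r [s ->]]; rewrite !Ho.
    (* The chain ends in a later block [l] than the block [n] where it starts: a point in a block
       after [n] is above the bottom, any other is below the top. *)
    destruct (lt_or_le n r) as [Hnr|Hrn]; [left; right; now left|].
    right; right; left; exact (le_lt_trans Hrn (HStr _ _ _ _ _ _ H0 H1)).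
  - intros n i; apply Hd; eauto.
  - intros n Hn; pose proof Hn as Hn'; apply HA' in Hn; destruct Hn as [k Hk].
    exists (npair n (k + 1 + 1)); rewrite !Hlt; split.
    + right; split; [reflexivity|]; exists k; split; [|auto].
      apply lt_succ_le, le_addr.
    + intros [H|[_ [k' [_ [_ [[E _]|[_ H]]]]]]];
        [exact (lt_irrefl H)|exact (H01 E)|]; apply (Hdisj n Hn'), HB'; eauto.
  - intros n Hn; pose proof Hn as Hn'; apply HB' in Hn; destruct Hn as [k Hk].
    exists (npair n (k + 1 + 1)); rewrite !Hlt; split.
    + right; split; [reflexivity|]; exists k; split; [|auto].
      apply lt_succ_le, le_addr.
    + intros [H|[_ [k' [_ [_ [[_ H]|[E _]]]]]]];
        [exact (lt_irrefl H)| |exact (H01 (eq_sym E))]; apply (Hdisj n); [|exact Hn'].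
      apply HA'; eauto.
Qed.

(** A point [c] below [p] but not below [q] has its right end before the left end of [p] and not
    before that of [q]. Comparing left endpoints thus reveals which of the two incomparable points
    of a block has received a lower point. *)
Lemma closed_orders_separation :
  (forall P : rel_structure M, partial_order P -> no_2plus2 P -> no_3plus1 P ->
     proper_closed_interval_order P) -> Sigma1_separation (M := M).
Proof.
  intros H A B HA HB Hdisj.
  destruct (coding_order HA HB Hdisj) as [P [HP [H22 [H31 [Hd [HPA HPB]]]]]].
  destruct (H P HP H22 H31) as [L [f0 [f1 [[HL [[Hf0 Hf0'] [Hf1 Hf1']]] [_ [H2 _]]]]]].
  assert (Hleft : forall c p q a b, olt P c p -> ~ olt P c q ->
            maps f0 p a -> maps f0 q b -> olt L b a).
  { intros c p q a b H1 H1' Hpa Hqb; destruct (olt_indom HP H1) as [Hc _].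
    destruct (Hf1' c Hc) as [z [Hz _]].
    apply (ole_olt_trans (proj1 HL) (q := z)).
    - apply (not_olt_ole HL);
        [apply (sub_prod_maps Hf1 Hz)|apply (sub_prod_maps Hf0 Hqb)|].
      now rewrite <- (H2 c q z b Hz Hqb).
    - now apply (H2 c p z a Hz Hpa). }
  assert (Hval : forall n i, exists a, maps f0 (npair n i) a).
  { intros n i; destruct (Hf0' (npair n i) (Hd n i)) as [a [Ha _]]; eauto. }
  assert (Hfun : forall p a b, maps f0 p a -> maps f0 p b -> a = b).
  { intros p a b Ha Hb; destruct (Hf0' p (proj1 (sub_prod_maps Hf0 Ha))) as [z [_ Hz]].
    now rewrite <- (Hz a Ha), <- (Hz b Hb). }
  destruct (@Del_comprehension _ _ (fun n => exists a b, maps f0 (npair n 0) a /\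
    maps f0 (npair n 1) b /\ ole L a b)) as [X HX].
  { split.
    - apply Sig_ex, Sig_ex, Del_Sig.
      del_with ltac:(first [apply Del_maps; fn | apply Del_ole; fn]).
    - apply Sig_ext with (fun v => exists a b, maps f0 (npair (v O) 0) a /\
        maps f0 (npair (v O) 1) b /\ ~ ole L a b).
      + intros v; split.
        * intros [a [b [Ha [Hb Hn]]]] [a' [b' [Ha' [Hb' Hab]]]].
          now rewrite (Hfun _ _ _ Ha Ha'), (Hfun _ _ _ Hb Hb') in Hn.
        * intros Hn; destruct (Hval (v O) 0) as [a Ha], (Hval (v O) 1) as [b Hb].
          exists a, b; split; [exact Ha|split; [exact Hb|]]; intros Hab; apply Hn.
          now exists a, b.
      + apply Sig_ex, Sig_ex, Del_Sig.
        del_with ltac:(first [apply Del_maps; fn | apply Del_ole; fn]). }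
  exists X; split; intros n Hn; rewrite HX.
  - destruct (HPA n Hn) as [c [H1 H1']].
    destruct (Hval n 0) as [a Ha], (Hval n 1) as [b Hb]; exists a, b.
    split; [exact Ha|split; [exact Hb|]]; exact (proj1 (Hleft _ _ _ _ _ H1 H1' Hb Ha)).
  - destruct (HPB n Hn) as [c [H1 H1']]; intros [a [b [Ha [Hb Hab]]]].
    apply (@olt_irrefl _ L a).
    exact (ole_olt_trans (proj1 HL) Hab (Hleft _ _ _ _ _ H1 H1' Ha Hb)).
Qed.

(* Incomparable convex sets are ordered by any choice of points in the two
   differences, so the comparison can be decided by searching for such points. *)
Lemma interval_orders_separation :
  (forall P : rel_structure M, partial_order P -> no_2plus2 P -> no_3plus1 P ->
     proper_11_interval_order P) -> Sigma1_separation (M := M).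
Proof.
  intros H A B HA HB Hdisj.
  destruct (coding_order HA HB Hdisj) as [P [HP [H22 [H31 [Hd [HPA HPB]]]]]].
  destruct (H P HP H22 H31) as [L [F [HL [HF [H1 [H2 [H3 H4]]]]]]].
  pose (left_of p q := exists u w, (maps F p u /\ ~ maps F q u) /\
    (maps F q w /\ ~ maps F p w) /\ olt L u w).
  assert (Hasym : forall p q, indom P p -> indom P q ->
            left_of p q -> left_of q p -> False).
  { intros p q Hp Hq [u [w [[Hu Hu'] [[Hw Hw'] Huw]]]] [w' [u' [[Hx Hx'] [[Hy Hy'] Hwu]]]].
    assert (Hwdom : indom L w) by apply (sub_prod_maps HF Hw).
    assert (Hudom : indom L u') by apply (sub_prod_maps HF Hy).
    (* Whichever of [w] and [u'] comes first lies between two points of the other interval, which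
       convexity forbids. *)
    destruct (olt_total HL Hwdom Hudom) as [Hlt|Hlt].
    - intros ->; tauto.
    - apply Hw', (proj2 (H1 p Hp) u w u' Hu Hy Huw Hlt).
    - apply Hy', (proj2 (H1 q Hq) w' u' w Hx Hw Hwu Hlt). }
  (* An inclusion would be an equality by (i4), which (i3) rules out. *)
  assert (Hdiff : forall p q, indom P p -> indom P q -> p <> q ->
            exists u, maps F p u /\ ~ maps F q u).
  { intros p q Hp Hq Hne; apply NNPP; intros Hn; apply (H3 p q Hp Hq Hne).
    apply (H4 p q Hp Hq); intros x Hx; apply NNPP; eauto. }
  assert (Htot : forall p q, indom P p -> indom P q -> p <> q -> left_of p q \/ left_of q p).
  { intros p q Hp Hq Hne; destruct (Hdiff p q Hp Hq Hne) as [u [Hu Hu']].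
    destruct (Hdiff q p Hq Hp (not_eq_sym Hne)) as [w [Hw Hw']].
    destruct (olt_total HL (proj2 (sub_prod_maps HF Hu)) (proj2 (sub_prod_maps HF Hw)))
      as [Hlt|Hlt]; [intros ->; tauto|left; exists u, w|right; exists w, u]; auto. }
  assert (Hleft : forall c p q, indom P p -> indom P q -> olt P c p -> ~ olt P c q ->
            left_of q p).
  { intros c p q Hp Hq Hcp Hcq; destruct (olt_indom HP Hcp) as [Hc _].
    assert (Hx : exists x y, maps F c x /\ maps F q y /\ ole L y x).
    { apply NNPP; intros Hn; apply Hcq, (H2 c q Hc Hq); intros x y Hx Hy.
      apply NNPP; intros Hxy; apply Hn; exists x, y; split; [exact Hx|split; [exact Hy|]].
      apply (not_olt_ole HL); [apply (sub_prod_maps HF Hx)|apply (sub_prod_maps HF Hy)|exact Hxy]. }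
    destruct Hx as [x [y [Hx [Hy Hyx]]]].
    assert (Hyp : forall z, maps F p z -> olt L y z).
    { intros z Hz; apply (ole_olt_trans (proj1 HL) Hyx).
      exact (proj1 (H2 c p Hc Hp) Hcp x z Hx Hz). }
    assert (Hne : p <> q) by (intros ->; tauto).
    destruct (Hdiff p q Hp Hq Hne) as [w [Hw Hw']]; exists y, w.
    split; [split; [exact Hy|]|split; [auto|now apply Hyp]].
    intros Hy'; exact (olt_irrefl (Hyp y Hy')). }
  assert (Hne : forall n : num M, npair n 0 <> npair n 1)
    by (intros n E; apply npair_inj in E; exact (zero_neq_one (proj2 E))).
  assert (Hsig : forall t u : env -> num M, Fn t -> Fn u ->
            Sig (fun v => left_of (t v) (u v))).
  { intros t u Ht Hu; apply Sig_ex, Sig_ex, Del_Sig.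
    del_with ltac:(first [apply Del_maps; fn | apply Del_olt; fn]). }
  destruct (@Del_comprehension _ _ (fun n => left_of (npair n 0) (npair n 1))) as [X HX].
  { split; [apply Hsig; fn|].
    apply Sig_ext with (fun v => left_of (npair (v O) 1) (npair (v O) 0));
      [|apply Hsig; fn].
    intros v; split; [intros Hl Hl'; exact (Hasym _ _ (Hd _ _) (Hd _ _) Hl Hl')|].
    intros Hn; destruct (Htot _ _ (Hd (v O) 0) (Hd (v O) 1) (Hne (v O))); tauto. }
  exists X; split; intros n Hn; rewrite HX.
  - destruct (HPA n Hn) as [c [Hc Hc']]; exact (Hleft _ _ _ (Hd _ _) (Hd _ _) Hc Hc').
  - destruct (HPB n Hn) as [c [Hc Hc']]; intros Hl.
    exact (Hasym _ _ (Hd _ _) (Hd _ _) Hl (Hleft _ _ _ (Hd _ _) (Hd _ _) Hc Hc')).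
Qed.

End Reversal.

Theorem theorem1p4 :
  forall M : L2_structure, RCA0 M ->
    (WKL0 M <->
       (forall P : rel_structure M, partial_order P ->
          (proper_11_interval_order P <-> no_2plus2 P /\ no_3plus1 P))) /\
    (WKL0 M <->
       (forall P : rel_structure M, partial_order P ->
          (proper_closed_interval_order P <-> no_2plus2 P /\ no_3plus1 P))) /\
    (WKL0 M <->
       (forall P : rel_structure M, partial_order P ->
          (proper_11_closed_interval_order P <->
             no_2plus2 P /\ no_3plus1 P))) /\
    (WKL0 M <->
       (forall P : rel_structure M, partial_order P ->
          (proper_distinguishing_interval_order P <->
             no_2plus2 P /\ no_3plus1 P))).
Proof.
  intros M HM.
  (* Distinguishing representations induce the other three kinds, so one construction serves all
     four equivalences. *)
  assert (Hforward : WKL0 M -> forall P : rel_structure M, partial_order P ->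
            no_2plus2 P /\ no_3plus1 P -> proper_distinguishing_interval_order P).
  { intros [_ HW] P HP [H22 H31].
    exact (semiorder_distinguishing (WKL_separation HW) HP H22 H31). }
  assert (Hdc := @distinguishing_proper_11_closed M).
  assert (Hcc := @proper_11_closed_closed M).
  assert (Hci := @proper_11_closed_proper_11 M HM).
  assert (Hcs := @proper_closed_interval_order_sound M HM).
  assert (His := @proper_11_interval_order_sound M HM).
  (* Closed representations are the weakest of the three kinds with endpoints, so one reversal
     covers those. Intervals in the sense of (i1) may lack endpoints and are reversed separately. *)
  assert (Hback : (forall P : rel_structure M, partial_order P ->
            no_2plus2 P -> no_3plus1 P -> proper_closed_interval_order P) -> WKL0 M)
    by (intros H; split; [exact HM|]; exact (separation_WKL (closed_orders_separation H))).
  split; [|split; [|split]]; (split; [intros HW P HP; split; [|intros H]|intros H]).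
  - exact (His P HP).
  - exact (Hci P (Hdc P (Hforward HW P HP H))).
  - split; [exact HM|]; apply separation_WKL, interval_orders_separation.
    intros P HP H22 H31; now apply H.
  - exact (Hcs P HP).
  - exact (Hcc P (Hdc P (Hforward HW P HP H))).
  - apply Hback; intros P HP H22 H31; now apply H.
  - intros H; exact (Hcs P HP (Hcc P H)).
  - exact (Hdc P (Hforward HW P HP H)).
  - apply Hback; intros P HP H22 H31; now apply Hcc, H.
  - intros H; exact (Hcs P HP (Hcc P (Hdc P H))).
  - exact (Hforward HW P HP H).
  - apply Hback; intros P HP H22 H31; now apply Hcc, Hdc, H.
Qed.
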